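(* Let $\mathcal{C},\mathcal{D}$ be unitary multifusion categories and $\mathcal{M}$ a $\mathcal{C}|\mathcal{D}$-bimodule category (a gapped domain wall). Then the domain wall tube algebra $\mathbf{Tube}({}_{\mathcal{C}}\mathcal{M}_{\mathcal{D}})$ is isomorphic to the crossed product $\mathbf{R}(\mathcal{M}_{\mathcal{D}})\Join\mathbf{L}({}_{\mathcal{C}}\mathcal{M})$.
   Context: A unitary multifusion category is a finite semisimple $\mathbb{C}$-linear rigid monoidal category with compatible unitary dagger structure $\dagger$; its unit decomposes as $\mathbf{1}=\bigoplus_i\mathbf{1}_i$ with $\mathbf{1}_i$ simple. $\mathcal{M}$ is a finite semisimple unitary bimodule category. $\mathrm{Irr}$ denotes representatives of the simple objects (containing all simple summands of the units); $d_x$ is the quantum dimension of a simple object $x$ (of $\mathcal{C}$, $\mathcal{D}$ or $\mathcal{M}$) and $\bar a,\bar b$ denote duals in $\mathcal{C},\mathcal{D}$. Associators are suppressed. ''Dual bases'' $p,p^*$ of $\mathrm{Hom}(k,A)$, $\mathrm{Hom}(A,k)$ ($k$ simple) satisfy $p^*p'=\delta_{p,p'}\mathrm{id}_k$. Labels: $a\in\mathrm{Irr}(\mathcal{C})$, $b\in\mathrm{Irr}(\mathcal{D})$, $c,d,e,f,g,h\in\mathrm{Irr}(\mathcal{M})$. Domain wall tube algebra. $\mathbf{Tube}({}_{\mathcal{C}}\mathcal{M}_{\mathcal{D}})$ is spanned by tube diagrams: a vertical line (the wall) interrupted in the middle, with a lower part $v=(\nu\otimes\mathrm{id}_b)\mu\in\mathrm{Hom}(c,a\otimes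 e\otimes b)$, where $\mu\in\mathrm{Hom}(c,d\otimes b)$, $\nu\in\mathrm{Hom}(d,a\otimes e)$, and an upper part $w=\gamma(\zeta\otimes\mathrm{id}_b)\in\mathrm{Hom}(a\otimes f\otimes b,h)$, where $\zeta\in\mathrm{Hom}(a\otimes f,g)$, $\gamma\in\mathrm{Hom}(g\otimes b,h)$; the two parts are joined by a half-circle $a$ on the left and a half-circle $b$ on the right. Thus $\mathbf{Tube}({}_{\mathcal{C}}\mathcal{M}_{\mathcal{D}})=\bigoplus_{a,b,c,e,f,h}\mathrm{Hom}(c,a\otimes e\otimes b)\otimes\mathrm{Hom}(a\otimes f\otimes b,h)$, with elements $v\otimes w$. It is a $C^*$ weak Hopf algebra as follows. Product: $(v\otimes w)(v'\otimes w')$ is $\delta_{f,h'}\delta_{e,c'}$ times the diagram with the second tube placed inside the first, the parallel strands $a,a'$ and $b',b$ being resolved into simples; i.e. $\delta_{f,h'}\delta_{e,c'}\sum_{k,s,p,q}\big((p^*\otimes\mathrm{id}_{e'}\otimes q^* )(\mathrm{id}_a\otimes v'\otimes\mathrm{id}_b)v\big)\otimes\big(w(\mathrm{id}_a\otimes w'\otimes\mathrm{id}_b)(p\otimes\mathrm{id}_{f'}\otimes q)\big)$, with dual bases $p,p^*$ for $k\in\mathrm{Irr}(\mathcal{C})$ in $a\otimes a'$ and $q,q^*$ for $s\in\mathrm{Irr}(\mathcal{D})$ in $b'\otimes b$. Unit: the sum of $\mathrm{id}_y\otimes\mathrm{id}_x$ over $x,y\in\mathrm{Irr}(\mathcal{M})$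 in a common component $\mathbf{1}^{\mathcal{C}}_i\otimes\mathcal{M}\otimes\mathbf{1}^{\mathcal{D}}_j$ (with $a=\mathbf{1}^{\mathcal{C}}_i$, $b=\mathbf{1}^{\mathcal{D}}_j$, $c=e=y$, $f=h=x$). Counit: $\varepsilon(v\otimes w)\,\mathrm{id}_h=\delta_{e,f}\delta_{c,h}\,w\circ v$. Coproduct: $\Delta(v\otimes w)=\sum_{i,k,p}(v_p\otimes w)\otimes(v\otimes w_p)$ with $i,k\in\mathrm{Irr}(\mathcal{M})$ and $v_p,w_p$ dual bases of $\mathrm{Hom}(k,a\otimes i\otimes b)$, $\mathrm{Hom}(a\otimes i\otimes b,k)$. Antipode: $S(v\otimes w)=\frac{d_f}{d_h}\,w^\flat\otimes v^\sharp$, where $w^\flat\in\mathrm{Hom}(f,\bar a\otimes h\otimes\bar b)$ and $v^\sharp\in\mathrm{Hom}(\bar a\otimes c\otimes\bar b,e)$ are obtained from $w$ and $v$ by bending the $a$- and $b$-strands with the duality maps. Star: $(v\otimes w)^*=\frac{d_e}{d_c}\,(v^\dagger)^\flat\otimes(w^\dagger)^\sharp$ with $(v^\dagger)^\flat\in\mathrm{Hom}(e,\bar a\otimes c\otimes\bar b)$, $(w^\dagger)^\sharp\in\mathrm{Hom}(\bar a\otimes h\otimes\bar b,f)$, extended antilinearly. Subalgebras. $\mathbf{L}({}_{\mathcal{C}}\mathcal{M})\subset\mathbf{Tube}({}_{\mathcal{C}}\mathcal{M}_{\mathcal{D}})$ is the subalgebra spanned by the diagrams whose right half-circle is labelled by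 the tensor unit (i.e. by a simple summand of $\mathbf{1}^{\mathcal{D}}$); its elements are $l=\nu\otimes\zeta$ with $\nu\in\mathrm{Hom}(d',a\otimes e)$, $\zeta\in\mathrm{Hom}(a\otimes f,g')$. $\mathbf{R}(\mathcal{M}_{\mathcal{D}})$ is the subalgebra spanned by the diagrams whose left half-circle is labelled by the tensor unit (a simple summand of $\mathbf{1}^{\mathcal{C}}$); its elements are $r=\mu\otimes\gamma$ with $\mu\in\mathrm{Hom}(c,d\otimes b)$, $\gamma\in\mathrm{Hom}(g\otimes b,h)$. Crossed product. For such $r$ and $l$, $r\Join l$ is defined by placing $l$ inside $r$: it corresponds to $\delta_{g,g'}\delta_{d,d'}\,\big((\nu\otimes\mathrm{id}_b)\mu\big)\otimes\big(\gamma(\zeta\otimes\mathrm{id}_b)\big)$, the tube diagram with vertices $\mu,\nu,\zeta,\gamma$. The crossed product $\mathbf{R}(\mathcal{M}_{\mathcal{D}})\Join\mathbf{L}({}_{\mathcal{C}}\mathcal{M})$ consists of the linear combinations of such $r\Join l$, with multiplication inherited directly from the tube diagrams; one has $\Delta(r\Join l)=\Delta(r)\Join\Delta(l)$. *)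

(* Defs.v *)
From HB Require Import structures.
From mathcomp Require Import all_boot all_order all_algebra.

Set Implicit Arguments.
Unset Strict Implicit.
Unset Printing Implicit Defensive.

Import GRing.Theory Num.Theory.
Local Open Scope ring_scope.

(** Throughout, [K] plays the role of the complex numbers; [z^*] is complex
    conjugation, and [0 < z] in [K] entails that [z] is real. *)

Declare Scope ucat_scope.
Delimit Scope ucat_scope with UC.
Local Open Scope ucat_scope.

(** * Unitary categories *)

Record dagger_cat (K : numClosedFieldType) := DaggerCat {
  obj :> Type;
  hom : obj -> obj -> vectType K;
  idm : forall A, hom A A;
  comp : forall A B C, hom B C -> hom A B -> hom A C;
  dag : forall A B, hom A B -> hom B A;
  comp1m : forall A B (f : hom A B), comp (idm B) f = f;
  compm1 : forall A B (f : hom A B), comp f (idm A) = f;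
  compA : forall A B C D (h : hom C D) (g : hom B C) (f : hom A B),
    comp h (comp g f) = comp (comp h g) f;
  comp_linl : forall A B C (k : K) (g g' : hom B C) (f : hom A B),
    comp (k *: g + g') f = k *: comp g f + comp g' f;
  comp_linr : forall A B C (k : K) (g : hom B C) (f f' : hom A B),
    comp g (k *: f + f') = k *: comp g f + comp g f';
  dagK : forall A B (f : hom A B), dag (dag f) = f;
  dag_comp : forall A B C (g : hom B C) (f : hom A B),
    dag (comp g f) = comp (dag f) (dag g);
  dag_antilin : forall A B (k : K) (f f' : hom A B),
    dag (k *: f + f') = k^* *: dag f + dag f'
}.

Notation "g ∘ f" := (comp g f) (at level 40, left associativity) : ucat_scope.
Notation "f ^†" := (dag f) (at level 3, left associativity, format "f ^†") : ucat_scope.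

Section DaggerNotions.
Context (K : numClosedFieldType) (U : dagger_cat K).

Definition unitary (A B : U) (f : hom A B) : Prop :=
  f^† ∘ f = idm A /\ f ∘ f^† = idm B.

Definition isomorphic (A B : U) : Prop :=
  exists (f : hom A B) (g : hom B A), g ∘ f = idm A /\ f ∘ g = idm B.

Definition simple (A : U) : Prop := \dim {: hom A A} = 1%N.

Definition is_orthogonal_sum (T : finType) (F : T -> U) (A : U)
    (j : forall t, hom (F t) A) : Prop :=
  [/\ forall t, (j t)^† ∘ j t = idm (F t),
      forall t t', t != t' -> (j t)^† ∘ j t' = 0
    & \sum_t j t ∘ (j t)^† = idm A].

(** The scalar [k] such that [f = k *: idm A], for [A] simple. *)
Definition scalar_of (A : U) (f : hom A A) : K :=
  coord [tuple idm A] ord0 f.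

End DaggerNotions.

(** Since there are orthogonal direct sums (including the empty one) and the
    hom spaces are finite dimensional, definiteness of [f^† ∘ f] makes every
    endomorphism algebra a C*-algebra.  Idempotents split because every object
    is a sum of simple objects. *)
Record unitary_cat (K : numClosedFieldType) := UnitaryCat {
  ucat :> dagger_cat K;
  dag_definite : forall (A B : ucat) (f : hom A B), f^† ∘ f = 0 -> f = 0;
  has_sums : forall n (F : 'I_n -> ucat), exists (A : ucat)
    (j : forall t, hom (F t) A), is_orthogonal_sum j;
  semisimple : forall A : ucat, exists n (F : 'I_n -> ucat)
    (j : forall t, hom (F t) A), (forall t, simple (F t)) /\ is_orthogonal_sum j
}.

(** A choice of finitely many representatives of the simple objects, and of dual
    bases [p_i : hom k A], [p^*_i : hom A k] for all simple [k] and all [A]. *)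
Record irreducibles (K : numClosedFieldType) (U : unitary_cat K) := Irreducibles {
  irr :> finType;
  iob : irr -> U;
  iob_simple : forall x, simple (iob x);
  iob_inj : forall x y, isomorphic (iob x) (iob y) -> x = y;
  iob_surj : forall A : U, simple A -> exists x, isomorphic A (iob x);
  pbas : forall k A, 'I_(\dim {: hom (iob k) A}) -> hom (iob k) A;
  pdual : forall k A, 'I_(\dim {: hom (iob k) A}) -> hom A (iob k);
  pdualP : forall k A i j,
    @pdual k A i ∘ @pbas k A j = if i == j then idm (iob k) else 0
}.

Section Delta.
Context (K : numClosedFieldType) (U : unitary_cat K) (I : irreducibles U).

(** [delta x y] is the identity if [x = y], and [0] otherwise. *)
Definition delta (x y : I) : hom (iob x) (iob y) :=
  match x =P y with
  | ReflectT e => ecast z (hom (iob x) (iob z)) e (idm (iob x))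
  | ReflectF _ => 0
  end.

End Delta.

(** * Unitary multifusion categories *)

Record monoidal_cat (K : numClosedFieldType) := MonoidalCat {
  mcat :> unitary_cat K;
  ten : mcat -> mcat -> mcat;
  tenm : forall A A' B B' : mcat,
    hom A A' -> hom B B' -> hom (ten A B) (ten A' B');
  one : mcat;
  assoc : forall A B C : mcat, hom (ten (ten A B) C) (ten A (ten B C));
  lunit : forall A : mcat, hom (ten one A) A;
  runit : forall A : mcat, hom (ten A one) A;
  tenm_id : forall A B : mcat, tenm (idm A) (idm B) = idm (ten A B);
  tenm_comp : forall (A A' A'' B B' B'' : mcat) (f' : hom A' A'') (f : hom A A')
      (g' : hom B' B'') (g : hom B B'),
    tenm (f' ∘ f) (g' ∘ g) = tenm f' g' ∘ tenm f g;
  tenm_linl : forall (A A' B B' : mcat) k (f f' : hom A A') (g : hom B B'),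
    tenm (k *: f + f') g = k *: tenm f g + tenm f' g;
  tenm_linr : forall (A A' B B' : mcat) k (f : hom A A') (g g' : hom B B'),
    tenm f (k *: g + g') = k *: tenm f g + tenm f g';
  tenm_dag : forall (A A' B B' : mcat) (f : hom A A') (g : hom B B'),
    (tenm f g)^† = tenm f^† g^†;
  assoc_unitary : forall A B C, unitary (assoc A B C);
  lunit_unitary : forall A, unitary (lunit A);
  runit_unitary : forall A, unitary (runit A);
  assoc_nat : forall (A A' B B' C C' : mcat)
      (f : hom A A') (g : hom B B') (h : hom C C'),
    assoc A' B' C' ∘ tenm (tenm f g) h = tenm f (tenm g h) ∘ assoc A B C;
  lunit_nat : forall (A A' : mcat) (f : hom A A'),
    lunit A' ∘ tenm (idm one) f = f ∘ lunit A;
  runit_nat : forall (A A' : mcat) (f : hom A A'),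
    runit A' ∘ tenm f (idm one) = f ∘ runit A;
  pentagon : forall A B C D : mcat,
    assoc A B (ten C D) ∘ assoc (ten A B) C D =
    tenm (idm A) (assoc B C D) ∘ assoc A (ten B C) D
      ∘ tenm (assoc A B C) (idm D);
  triangle : forall A B : mcat,
    tenm (idm A) (lunit B) ∘ assoc A one B = tenm (runit A) (idm B)
}.

Notation "A ⊗ B" := (ten A B) (at level 36, right associativity) : ucat_scope.
Notation "f ⊗m g" := (tenm f g) (at level 36, right associativity) : ucat_scope.
Notation "'𝟙' C" := (one C) (at level 9, C at level 8) : ucat_scope.

Definition duality (K : numClosedFieldType) (C : monoidal_cat K) (A B : C)
    (ev : hom (B ⊗ A) (𝟙 C)) (coev : hom (𝟙 C) (A ⊗ B)) : Prop :=
  runit A ∘ (idm A ⊗m ev) ∘ assoc A B A ∘ (coev ⊗m idm A) ∘ (lunit A)^†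
    = idm A /\
  lunit B ∘ (ev ⊗m idm B) ∘ (assoc B A B)^† ∘ (idm B ⊗m coev) ∘ (runit B)^†
    = idm B.

(** One-sided duals suffice: the dagger turns them into two-sided duals. *)
Record multifusion (K : numClosedFieldType) := Multifusion {
  mfcat :> monoidal_cat K;
  rigid : forall A : mfcat, exists (B : mfcat)
    (ev : hom (B ⊗ A) (𝟙 mfcat)) (coev : hom (𝟙 mfcat) (A ⊗ B)),
    duality ev coev
}.

(** Representatives of the simple objects containing the simple summands [usum i]
    of the unit, closed under duals ([bar]).  The duality maps of the simple
    objects are normalised so that both loops, [coev^† ∘ coev] and [ev ∘ ev^†],
    have the same value [qdim a]: this is the quantum dimension. *)
Record multifusion_irr (K : numClosedFieldType) (C : multifusion K) :=
  MultifusionIrr {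
  mirr :> irreducibles C;
  ucomp : finType;
  usum : ucomp -> mirr;
  usum_inj : injective usum;
  uinc : forall i, hom (iob (usum i)) (𝟙 C);
  uincP : is_orthogonal_sum uinc;
  bar : mirr -> mirr;
  ev : forall a, hom (iob (bar a) ⊗ iob a) (𝟙 C);
  coev : forall a, hom (𝟙 C) (iob a ⊗ iob (bar a));
  ev_coev : forall a, duality (ev a) (coev a);
  qdim : mirr -> K;
  qdim_gt0 : forall a, 0 < qdim a;
  qdim_coev : forall a, exists i,
    (coev a)^† ∘ coev a = qdim a *: (uinc i ∘ (uinc i)^†);
  qdim_ev : forall a, exists j,
    ev a ∘ (ev a)^† = qdim a *: (uinc j ∘ (uinc j)^†)
}.

(** The inclusion of [a] into the tensor unit if [a] is one of its chosen simple
    summands, and [0] otherwise. *)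
Definition uincl (K : numClosedFieldType) (C : multifusion K)
    (IC : multifusion_irr C) (a : IC) : hom (iob a) (𝟙 C) :=
  \sum_i uinc i ∘ delta a (usum i).

(** * Bimodule categories *)

Record bimodule_cat (K : numClosedFieldType) (C D : monoidal_cat K) :=
  BimoduleCat {
  bcat :> unitary_cat K;
  lact : C -> bcat -> bcat;
  ract : bcat -> D -> bcat;
  lactm : forall (A A' : C) (X X' : bcat),
    hom A A' -> hom X X' -> hom (lact A X) (lact A' X');
  ractm : forall (X X' : bcat) (B B' : D),
    hom X X' -> hom B B' -> hom (ract X B) (ract X' B');
  lassoc : forall (A A' : C) (X : bcat),
    hom (lact (A ⊗ A') X) (lact A (lact A' X));
  rassoc : forall (X : bcat) (B B' : D),
    hom (ract (ract X B) B') (ract X (B ⊗ B'));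
  massoc : forall (A : C) (X : bcat) (B : D),
    hom (ract (lact A X) B) (lact A (ract X B));
  lunitor : forall X : bcat, hom (lact (𝟙 C) X) X;
  runitor : forall X : bcat, hom (ract X (𝟙 D)) X;
  lactm_id : forall (A : C) (X : bcat), lactm (idm A) (idm X) = idm (lact A X);
  ractm_id : forall (X : bcat) (B : D), ractm (idm X) (idm B) = idm (ract X B);
  lactm_comp : forall (A A' A'' : C) (X X' X'' : bcat)
      (f' : hom A' A'') (f : hom A A') (g' : hom X' X'') (g : hom X X'),
    lactm (f' ∘ f) (g' ∘ g) = lactm f' g' ∘ lactm f g;
  ractm_comp : forall (X X' X'' : bcat) (B B' B'' : D)
      (f' : hom X' X'') (f : hom X X') (g' : hom B' B'') (g : hom B B'),
    ractm (f' ∘ f) (g' ∘ g) = ractm f' g' ∘ ractm f g;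
  lactm_linl : forall (A A' : C) (X X' : bcat) k
      (f f' : hom A A') (g : hom X X'),
    lactm (k *: f + f') g = k *: lactm f g + lactm f' g;
  lactm_linr : forall (A A' : C) (X X' : bcat) k
      (f : hom A A') (g g' : hom X X'),
    lactm f (k *: g + g') = k *: lactm f g + lactm f g';
  ractm_linl : forall (X X' : bcat) (B B' : D) k
      (f f' : hom X X') (g : hom B B'),
    ractm (k *: f + f') g = k *: ractm f g + ractm f' g;
  ractm_linr : forall (X X' : bcat) (B B' : D) k
      (f : hom X X') (g g' : hom B B'),
    ractm f (k *: g + g') = k *: ractm f g + ractm f g';
  lactm_dag : forall (A A' : C) (X X' : bcat) (f : hom A A') (g : hom X X'),
    (lactm f g)^† = lactm f^† g^†;
  ractm_dag : forall (X X' : bcat) (B B' : D) (f : hom X X') (g : hom B B'),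
    (ractm f g)^† = ractm f^† g^†;
  lassoc_unitary : forall A A' X, unitary (lassoc A A' X);
  rassoc_unitary : forall X B B', unitary (rassoc X B B');
  massoc_unitary : forall A X B, unitary (massoc A X B);
  lunitor_unitary : forall X, unitary (lunitor X);
  runitor_unitary : forall X, unitary (runitor X);
  lassoc_nat : forall (A1 A2 A1' A2' : C) (X X' : bcat)
      (f1 : hom A1 A1') (f2 : hom A2 A2') (g : hom X X'),
    lassoc A1' A2' X' ∘ lactm (f1 ⊗m f2) g =
    lactm f1 (lactm f2 g) ∘ lassoc A1 A2 X;
  rassoc_nat : forall (X X' : bcat) (B1 B2 B1' B2' : D)
      (g : hom X X') (f1 : hom B1 B1') (f2 : hom B2 B2'),
    rassoc X' B1' B2' ∘ ractm (ractm g f1) f2 =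
    ractm g (f1 ⊗m f2) ∘ rassoc X B1 B2;
  massoc_nat : forall (A A' : C) (X X' : bcat) (B B' : D)
      (f : hom A A') (g : hom X X') (h : hom B B'),
    massoc A' X' B' ∘ ractm (lactm f g) h =
    lactm f (ractm g h) ∘ massoc A X B;
  lunitor_nat : forall (X X' : bcat) (g : hom X X'),
    lunitor X' ∘ lactm (idm (𝟙 C)) g = g ∘ lunitor X;
  runitor_nat : forall (X X' : bcat) (g : hom X X'),
    runitor X' ∘ ractm g (idm (𝟙 D)) = g ∘ runitor X;
  lpentagon : forall (A1 A2 A3 : C) (X : bcat),
    lassoc A1 A2 (lact A3 X) ∘ lassoc (A1 ⊗ A2) A3 X =
    lactm (idm A1) (lassoc A2 A3 X) ∘ lassoc A1 (A2 ⊗ A3) X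
      ∘ lactm (assoc A1 A2 A3) (idm X);
  rpentagon : forall (X : bcat) (B1 B2 B3 : D),
    rassoc X B1 (B2 ⊗ B3) ∘ rassoc (ract X B1) B2 B3 =
    ractm (idm X) (assoc B1 B2 B3) ∘ rassoc X (B1 ⊗ B2) B3
      ∘ ractm (rassoc X B1 B2) (idm B3);
  lmpentagon : forall (A1 A2 : C) (X : bcat) (B : D),
    lassoc A1 A2 (ract X B) ∘ massoc (A1 ⊗ A2) X B =
    lactm (idm A1) (massoc A2 X B) ∘ massoc A1 (lact A2 X) B
      ∘ ractm (lassoc A1 A2 X) (idm B);
  rmpentagon : forall (A : C) (X : bcat) (B1 B2 : D),
    massoc A X (B1 ⊗ B2) ∘ rassoc (lact A X) B1 B2 =
    lactm (idm A) (rassoc X B1 B2) ∘ massoc A (ract X B1) B2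
      ∘ ractm (massoc A X B1) (idm B2);
  ltriangle : forall (A : C) (X : bcat),
    lactm (idm A) (lunitor X) ∘ lassoc A (𝟙 C) X = lactm (runit A) (idm X);
  rtriangle : forall (X : bcat) (B : D),
    ractm (idm X) (lunit B) ∘ rassoc X (𝟙 D) B = ractm (runitor X) (idm B)
}.

Notation "A ⊳ X" := (lact A X) (at level 37, right associativity) : ucat_scope.
Notation "X ⊲ B" := (ract X B) (at level 38, left associativity) : ucat_scope.
Notation "f ⊳m g" := (lactm f g) (at level 37, right associativity) : ucat_scope.
Notation "f ⊲m g" := (ractm f g) (at level 38, left associativity) : ucat_scope.

(** Quantum dimensions of the simple objects of [M]: the positive solution, unique
    up to a factor on each indecomposable summand of [M], of
    [d_a d_x = \sum_y [A ⊳ x : y] d_y] and [d_x d_b = \sum_y [x ⊲ b : y] d_y].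
    In the multifusion case these are required only when the product on the left
    is not the zero object.  Only ratios of dimensions in a common summand enter
    below. *)
Record module_qdim (K : numClosedFieldType) (C D : multifusion K)
    (M : bimodule_cat C D) (IC : multifusion_irr C) (ID : multifusion_irr D)
    (IM : irreducibles M) := ModuleQdim {
  mqdim :> IM -> K;
  mqdim_gt0 : forall x, 0 < mqdim x;
  mqdim_lact : forall (a : IC) (x : IM),
    idm (iob a ⊳ iob x) != 0 ->
    qdim a * mqdim x =
      \sum_(y : IM) (\dim {: hom (iob y) (iob a ⊳ iob x)})%:R * mqdim y;
  mqdim_ract : forall (x : IM) (b : ID),
    idm (iob x ⊲ iob b) != 0 ->
    mqdim x * qdim b =
      \sum_(y : IM) (\dim {: hom (iob y) (iob x ⊲ iob b)})%:R * mqdim y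
}.

(** * Tensor products of finite-dimensional spaces, in coordinates *)

Section Tensor.
Context {K : fieldType}.

Definition tensor (V W : vectType K) := 'M[K]_(\dim {: V}, \dim {: W}).

Definition tpure (V W : vectType K) (v : V) (w : W) : tensor V W :=
  \matrix_(i, j) (coord (vbasis fullv) i v * coord (vbasis fullv) j w).

(** The linear map on [V ⊗ W] induced by the bilinear map [F]. *)
Definition tlift (V W U : vectType K) (F : V -> W -> U) (x : tensor V W) : U :=
  \sum_i \sum_j x i j *: F (vbasis fullv)`_i (vbasis fullv)`_j.

Definition tmap (V V' W W' : vectType K) (f : V -> V') (g : W -> W') :
    tensor V W -> tensor V' W' :=
  tlift (fun v w => tpure (f v) (g w)).

End Tensor.

(** * The structure maps of a C*-weak Hopf algebra *)

Record wha_ops (K : numClosedFieldType) (V : vectType K) := WhaOps {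
  wmul : V -> V -> V;
  wone : V;
  wcomul : V -> tensor V V;
  wcounit : V -> K;
  wantipode : V -> V;
  wstar : V -> V
}.

Definition wha_isomorphism (K : numClosedFieldType) (V W : vectType K)
    (H : wha_ops V) (H' : wha_ops W) (f : 'Hom(V, W)) : Prop :=
  [/\ bijective f,
      (forall x y, f (wmul H x y) = wmul H' (f x) (f y)) /\ f (wone H) = wone H',
      (forall x, wcomul H' (f x) = tmap f f (wcomul H x)) /\
      (forall x, wcounit H' (f x) = wcounit H x),
      forall x, wantipode H' (f x) = f (wantipode H x)
    & forall x, wstar H' (f x) = f (wstar H x)].

Definition wha_isomorphic (K : numClosedFieldType) (V W : vectType K)
    (H : wha_ops V) (H' : wha_ops W) : Prop :=
  exists f : 'Hom(V, W), wha_isomorphism H H' f.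

(** * The domain wall tube algebra *)

Record label (IC ID IM : finType) := Label {
  la : IC; lb : ID; lc : IM; le : IM; lf : IM; lh : IM }.

Section LabelFinType.
Context (IC ID IM : finType).

Definition label_tuple (l : label IC ID IM) :=
  (la l, lb l, lc l, le l, lf l, lh l).
Definition tuple_label (t : IC * ID * IM * IM * IM * IM) : label IC ID IM :=
  let: (a, b, c, e, f, h) := t in Label a b c e f h.
Lemma label_tupleK : cancel label_tuple tuple_label.
Proof. by case. Qed.

HB.instance Definition _ := Finite.copy (label IC ID IM) (can_type label_tupleK).

End LabelFinType.

Section TubeAlgebra.
Context (K : numClosedFieldType) (C D : multifusion K) (M : bimodule_cat C D).
Context (IC : multifusion_irr C) (ID : multifusion_irr D) (IM : irreducibles M).
Context (dM : module_qdim IC ID IM).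

(** In [M], the product [A ⊗ X ⊗ B] is bracketed as [(A ⊳ X) ⊲ B]. *)
Definition lbl := label IC ID IM.

Definition low (l : lbl) : vectType K :=
  hom (iob (lc l)) (iob (la l) ⊳ iob (le l) ⊲ iob (lb l)).
Definition upp (l : lbl) : vectType K :=
  hom (iob (la l) ⊳ iob (lf l) ⊲ iob (lb l)) (iob (lh l)).

(** Coordinates of the direct sum over all labels [l] of [low l ⊗ upp l]. *)
Definition tube_index : finType :=
  {l : lbl & ('I_(\dim {: low l}) * 'I_(\dim {: upp l}))%type}.
Definition tube : vectType K := {ffun tube_index -> K^o}.

Definition tube_inj (l : lbl) (x : tensor (low l) (upp l)) : tube :=
  [ffun t => untag 0 (fun p => x p.1 p.2) t].
Definition tube_proj (l : lbl) (x : tube) : tensor (low l) (upp l) :=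
  \matrix_(i, j) x (Tagged _ (i, j)).

(** The tube diagram [v ⊗ w]. *)
Definition diagram (l : lbl) (v : low l) (w : upp l) : tube :=
  tube_inj (tpure v w).

(** Extension, linear or antilinear, of maps given on tube diagrams. *)
Definition tube_lift (V : vectType K) (F : forall l, low l -> upp l -> V)
    (x : tube) : V := \sum_l tlift (F l) (tube_proj l x).
Definition tube_antilift (V : vectType K) (F : forall l, low l -> upp l -> V)
    (x : tube) : V := tube_lift F [ffun t => (x t)^*].

(** The associator [a (a' x b') b -> (a a') x (b' b)]. *)
Definition reassoc (A A' : C) (X : M) (B' B : D) :
    hom (A ⊳ (A' ⊳ X ⊲ B') ⊲ B) ((A ⊗ A') ⊳ X ⊲ (B' ⊗ B)) :=
  rassoc ((A ⊗ A') ⊳ X) B' B ∘ ((lassoc A A' X)^† ⊲m idm B' ⊲m idm B)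
    ∘ ((massoc A (A' ⊳ X) B')^† ⊲m idm B).

Definition biunitor (X : M) : hom (𝟙 C ⊳ X ⊲ 𝟙 D) X :=
  lunitor X ∘ runitor (𝟙 C ⊳ X).

(** [(v ⊗ w) (v' ⊗ w')]; the factors [delta (le l) (lc l')] and
    [delta (lh l') (lf l)] account for the two Kronecker deltas. *)
Definition diagram_mul (l : lbl) (v : low l) (w : upp l)
    (l' : lbl) (v' : low l') (w' : upp l') : tube :=
  \sum_(k : IC) \sum_(s : ID)
  \sum_(p < \dim {: hom (iob k) (iob (la l) ⊗ iob (la l'))})
  \sum_(q < \dim {: hom (iob s) (iob (lb l') ⊗ iob (lb l))})
    diagram (l := Label k s (lc l) (le l') (lf l') (lh l))
      ((pdual p ⊳m idm (iob (le l')) ⊲m pdual q)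
         ∘ reassoc (iob (la l)) (iob (la l')) (iob (le l'))
                   (iob (lb l')) (iob (lb l))
         ∘ (idm (iob (la l)) ⊳m (v' ∘ delta (le l) (lc l')) ⊲m idm (iob (lb l)))
         ∘ v)
      (w ∘ (idm (iob (la l)) ⊳m (delta (lh l') (lf l) ∘ w') ⊲m idm (iob (lb l)))
         ∘ (reassoc (iob (la l)) (iob (la l')) (iob (lf l'))
                    (iob (lb l')) (iob (lb l)))^†
         ∘ (pbas p ⊳m idm (iob (lf l')) ⊲m pbas q)).

Definition tube_mul (x y : tube) : tube :=
  tube_lift (fun l v w => tube_lift (diagram_mul v w) y) x.

(** The identity of [y] as a map [y -> 1_i y 1_j]; it is [0] when [y] is not in
    the component [1_i ⊗ M ⊗ 1_j]. *)
Definition unit_vertex (i : ucomp IC) (j : ucomp ID) (y : IM) :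
    hom (iob y) (iob (usum i) ⊳ iob y ⊲ iob (usum j)) :=
  ((uinc i)^† ⊳m idm (iob y) ⊲m (uinc j)^†) ∘ (biunitor (iob y))^†.

Definition tube_one : tube :=
  \sum_(i : ucomp IC) \sum_(j : ucomp ID) \sum_(x : IM) \sum_(y : IM)
    diagram (l := Label (usum i) (usum j) y y x x)
      (unit_vertex i j y) (unit_vertex i j x)^†.

Definition tube_counit : tube -> K :=
  tube_lift (V := K^o) (fun l v w =>
    scalar_of (w ∘ (idm (iob (la l)) ⊳m delta (le l) (lf l) ⊲m idm (iob (lb l)))
                 ∘ v ∘ delta (lh l) (lc l))).

Definition tube_comul : tube -> tensor tube tube :=
  tube_lift (fun l v w =>
    \sum_(i : IM) \sum_(k : IM)
    \sum_(p < \dim {: hom (iob k) (iob (la l) ⊳ iob i ⊲ iob (lb l))})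
      tpure (diagram (l := Label (la l) (lb l) k i (lf l) (lh l)) (pbas p) w)
            (diagram (l := Label (la l) (lb l) (lc l) (le l) i k) v (pdual p))).

(** Bending the [a]- and [b]-strands of a vertex, with the duality maps [ev] of
    [a] and [coev] of [b] and their daggers. *)
Definition sharp (a : IC) (b : ID) (X Y : M) (v : hom X (iob a ⊳ Y ⊲ iob b)) :
    hom (iob (bar a) ⊳ X ⊲ iob (bar b)) Y :=
  biunitor Y ∘ (ev a ⊳m idm Y ⊲m (coev b)^†)
    ∘ reassoc (iob (bar a)) (iob a) Y (iob b) (iob (bar b))
    ∘ (idm (iob (bar a)) ⊳m v ⊲m idm (iob (bar b))).

Definition flat (a : IC) (b : ID) (X Y : M) (w : hom (iob a ⊳ X ⊲ iob b) Y) :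
    hom X (iob (bar a) ⊳ Y ⊲ iob (bar b)) :=
  (idm (iob (bar a)) ⊳m w ⊲m idm (iob (bar b)))
    ∘ (reassoc (iob (bar a)) (iob a) X (iob b) (iob (bar b)))^†
    ∘ ((ev a)^† ⊳m idm X ⊲m coev b) ∘ (biunitor X)^†.

Definition tube_antipode : tube -> tube :=
  tube_lift (fun l v w => (dM (lf l) / dM (lh l)) *:
    diagram (l := Label (bar (la l)) (bar (lb l)) (lf l) (lh l) (lc l) (le l))
      (flat w) (sharp v)).

Definition tube_star : tube -> tube :=
  tube_antilift (fun l v w => (dM (le l) / dM (lc l)) *:
    diagram (l := Label (bar (la l)) (bar (lb l)) (le l) (lc l) (lh l) (lf l))
      (flat v^†) (sharp w^†)).

Definition tube_algebra : wha_ops tube :=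
  WhaOps tube_mul tube_one tube_comul tube_counit tube_antipode tube_star.

(** * The subspaces [L], [R] and the crossed product *)

Definition label_span (P : pred lbl) : {vspace tube} :=
  <<[seq [ffun t => (t == s)%:R] : tube
     | s <- enum tube_index & P (tag s)]>>%VS.

Definition Rtube : {vspace tube} :=
  label_span (fun l => la l \in codom (@usum _ _ IC)).
Definition Ltube : {vspace tube} :=
  label_span (fun l => lb l \in codom (@usum _ _ ID)).

(** The vertices [mu], [gamma] of a diagram of [Rtube] and [nu], [zeta] of a
    diagram of [Ltube], obtained by erasing the strand labelled by a summand of
    the unit. *)
Definition mu_of (l : lbl) (v : low l) :
    hom (iob (lc l)) (iob (le l) ⊲ iob (lb l)) :=
  ((lunitor _ ∘ (uincl (la l) ⊳m idm _)) ⊲m idm _) ∘ v.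
Definition gamma_of (l : lbl) (w : upp l) :
    hom (iob (lf l) ⊲ iob (lb l)) (iob (lh l)) :=
  w ∘ ((((uincl (la l))^† ⊳m idm _) ∘ (lunitor _)^†) ⊲m idm _).
Definition nu_of (l : lbl) (v : low l) :
    hom (iob (lc l)) (iob (la l) ⊳ iob (le l)) :=
  runitor _ ∘ (idm _ ⊲m uincl (lb l)) ∘ v.
Definition zeta_of (l : lbl) (w : upp l) :
    hom (iob (la l) ⊳ iob (lf l)) (iob (lh l)) :=
  w ∘ (idm _ ⊲m (uincl (lb l))^†) ∘ (runitor _)^†.

(** [r ⋈ l], bilinear; meaningful for [r] in [Rtube] and [l] in [Ltube]. *)
Definition diagram_join (r : lbl) (vr : low r) (wr : upp r)
    (l : lbl) (vl : low l) (wl : upp l) : tube :=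
  diagram (l := Label (la l) (lb r) (lc r) (le l) (lf l) (lh r))
    (((nu_of vl ∘ delta (le r) (lc l)) ⊲m idm (iob (lb r))) ∘ mu_of vr)
    (gamma_of wr ∘ ((delta (lh l) (lf r) ∘ zeta_of wl) ⊲m idm (iob (lb r)))).

Definition join (x y : tube) : tube :=
  tube_lift (fun r vr wr => tube_lift (diagram_join vr wr) y) x.

(** [(r1 ⊗ r2) ⋈ (l1 ⊗ l2) = (r1 ⋈ l1) ⊗ (r2 ⋈ l2)]. *)
Definition join2 (x y : tensor tube tube) : tensor tube tube :=
  tlift (fun r1 r2 => tlift (fun l1 l2 => tpure (join r1 l1) (join r2 l2)) y) x.

Definition crossed_product : {vspace tube} :=
  <<[seq join r l | r <- vbasis Rtube, l <- vbasis Ltube]>>%VS.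

(** The structure of the crossed product: the coproduct is determined by
    [Δ(r ⋈ l) = Δ(r) ⋈ Δ(l)], everything else is inherited from the tube
    diagrams (in particular, [crossed_product] is closed under the operations). *)
Definition crossed_product_structure (H : wha_ops (subvs_of crossed_product)) :
    Prop :=
  [/\ (forall x y, vsval (wmul H x y) = tube_mul (vsval x) (vsval y)) /\
      vsval (wone H) = tube_one,
      (forall k x y, wcomul H (k *: x + y) = k *: wcomul H x + wcomul H y) /\
      (forall x r l, r \in Rtube -> l \in Ltube -> vsval x = join r l ->
         tmap vsval vsval (wcomul H x) = join2 (tube_comul r) (tube_comul l)),
      forall x, wcounit H x = tube_counit (vsval x),
      forall x, vsval (wantipode H x) = tube_antipode (vsval x)
    & forall x, vsval (wstar H x) = tube_star (vsval x)].

End TubeAlgebra.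

Arguments tube_algebra {K C D M IC ID IM} dM.
Arguments crossed_product {K C D M} IC ID IM.
Arguments crossed_product_structure {K C D M IC ID IM} dM H.

(* Main.v *)
(** Resolving the identity of [a ⊳ e] into simple objects [d] factors a lower
    vertex [c -> a e b] as [c -> d b -> a e b], and dually for upper vertices, so
    every tube diagram is a sum of products [r ⋈ l]: the crossed product is the
    whole tube algebra.  The factors [r] and [l] must use the unit summands lying
    to the left of [a] and to the left of [b], respectively; that these act as the
    identity on [d] follows from the coherence of the unitors.

    What remains is [Δ(r ⋈ l) = Δ(r) ⋈ Δ(l)].  Composing dual bases of the factors
    gives on the right a family [x_t, y_t] with [\sum_t x_t ∘ y_t] equal to [s * t]
    on every simple subobject, [s] and [t] being the scalars by which the unit
    strands of [r] and [l] act on [a] and [b].  The same scalars satisfy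
    [V = (s * t) *: V] for the lower vertex [V] of [r ⋈ l], which absorbs them. *)

Require Import Defs.
From mathcomp Require Import all_boot all_order all_algebra.
From mathcomp Require Import complex reals.
Import Defs.

Set Implicit Arguments.
Unset Strict Implicit.
Unset Printing Implicit Defensive.

Import GRing.Theory Num.Theory.
Local Open Scope ring_scope.
Local Open Scope ucat_scope.

(** * Elementary consequences of linearity for unbundled maps *)

Section LinearMaps.
Context (K : fieldType) (U V : lmodType K) (f : U -> V) (fL : linear f).

Lemma linear_eq0 : f 0 = 0.
Proof. by have := fL (-1) 0 0; rewrite !scaleN1r oppr0 !addr0 addNr. Qed.

Lemma linear_scale k x : f (k *: x) = k *: f x.
Proof. by rewrite -[k *: x]addr0 fL linear_eq0 addr0. Qed.

Lemma linear_add x y : f (x + y) = f x + f y.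
Proof. by rewrite -[x]scale1r fL !scale1r. Qed.

Lemma linear_bigsum I r (P : pred I) F :
  f (\sum_(i <- r | P i) F i) = \sum_(i <- r | P i) f (F i).
Proof. exact: (big_morph f linear_add linear_eq0). Qed.

End LinearMaps.

Definition is_bilinear (K : fieldType) (U V W : lmodType K) (F : U -> V -> W) :=
  (forall v, linear (fun u => F u v)) /\ (forall u, linear (F u)).

(** * Tensor products in coordinates: universal property and functoriality *)

Section TensorTheory.
Context (K : fieldType).
Implicit Types (V W U : vectType K).

Lemma tpure_bilinear V W : is_bilinear (@tpure K V W).
Proof.
split=> [w k v v'|v k w w']; apply/matrixP=> i j; rewrite !mxE linearP /=.
  by rewrite mulrDl mulrA.
by rewrite mulrDr mulrCA.
Qed.

Lemma tlift_linear V W U (F : V -> W -> U) : linear (tlift F).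
Proof.
move=> k x y; rewrite /tlift scaler_sumr -big_split; apply: eq_bigr => i _ /=.
rewrite scaler_sumr -big_split; apply: eq_bigr => j _ /=.
by rewrite !mxE scalerDl scalerA.
Qed.


Lemma vect_expand V (v : V) :
  v = \sum_i coord (vbasis fullv) i v *: (vbasis fullv)`_i.
Proof. by rewrite -coord_vbasis ?memvf. Qed.

(** [tlift] samples [F] only at basis vectors; bilinearity recovers the values at arbitrary [v] and
    [w]. *)
Lemma tlift_pure V W U (F : V -> W -> U) v w :
  is_bilinear F -> tlift F (tpure v w) = F v w.
Proof.
move=> [Fl Fr]; rewrite [in RHS](vect_expand v) (linear_bigsum (Fl w)).
apply: eq_bigr => i _; rewrite (linear_scale (Fl w)).
rewrite [in RHS](vect_expand w) (linear_bigsum (Fr _)) scaler_sumr.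
by apply: eq_bigr => j _; rewrite (linear_scale (Fr _)) scalerA mxE.
Qed.

Lemma tensor_expand V W (x : tensor V W) :
  x = \sum_i \sum_j x i j *: tpure (vbasis fullv)`_i (vbasis fullv)`_j.
Proof.
have free_vb (Z : vectType K) := basis_free (vbasisP {: Z}).
apply/matrixP=> i j; rewrite summxE (bigD1 i) //= summxE (bigD1 j) //=.
rewrite !mxE !coord_free ?free_vb // !eqxx !mulr1 big1 => [|j' j'j]; last first.
  by rewrite !mxE !coord_free ?free_vb // (negPf j'j) !mulr0.
rewrite addr0 big1 ?addr0 // => i' i'i; rewrite summxE big1 // => j' _.
by rewrite !mxE !coord_free ?free_vb // (negPf i'i) mul0r mulr0.
Qed.

Lemma tensor_ind V W (P : tensor V W -> Prop) :
    (forall k x y, P x -> P y -> P (k *: x + y)) -> P 0 ->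
    (forall v w, P (tpure v w)) ->
  forall x, P x.
Proof.
move=> PL P0 Ppure x; rewrite (tensor_expand x).
have PD y z : P y -> P z -> P (y + z) by rewrite -{2}[y]scale1r; apply: PL.
apply: (big_ind P) => // i _; apply: (big_ind P) => // j _.
by rewrite -[_ *: _]addr0; apply: PL.
Qed.

Lemma bilinear_tpure V V' W W' (f : V -> V') (g : W -> W') :
  linear f -> linear g -> is_bilinear (fun v w => tpure (f v) (g w)).
Proof.
move=> fL gL; split=> [w|v] k x y; first by rewrite fL (tpure_bilinear _ _).1.
by rewrite gL (tpure_bilinear _ _).2.
Qed.

Lemma tmap_pure V V' W W' (f : V -> V') (g : W -> W') v w :
  linear f -> linear g -> tmap f g (tpure v w) = tpure (f v) (g w).
Proof. by move=> fL gL; apply: tlift_pure (bilinear_tpure fL gL). Qed.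

Lemma tmap_linear V V' W W' (f : V -> V') (g : W -> W') : linear (tmap f g).
Proof. exact: tlift_linear. Qed.

Lemma eq_tmap V V' W W' (f f' : V -> V') (g g' : W -> W') :
  f =1 f' -> g =1 g' -> tmap f g =1 tmap f' g'.
Proof.
by move=> ff' gg' x; apply: eq_bigr => i _; apply: eq_bigr => j _; rewrite ff' gg'.
Qed.

Lemma tmapK V V' W W' (f : V -> V') (g : W -> W') f' g' :
    linear f -> linear g -> linear f' -> linear g' ->
  cancel f f' -> cancel g g' -> cancel (tmap f g) (tmap f' g').
Proof.
move=> fL gL f'L g'L fK gK; apply: tensor_ind => [k x y xK yK||v w].
- by rewrite !tmap_linear xK yK.
- by rewrite !(linear_eq0 (tmap_linear _ _)).
by rewrite !tmap_pure // fK gK.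
Qed.

End TensorTheory.

(** * Composition in a dagger category and endomorphisms of simple objects *)

Section DaggerTheory.
Context (K : numClosedFieldType) (U : dagger_cat K).
Implicit Types A B C : U.

Lemma comp_linear_l A B C (f : hom A B) : linear (fun g : hom B C => g ∘ f).
Proof. by move=> k g g'; apply: comp_linl. Qed.

Lemma comp_linear_r A B C (g : hom B C) : linear (fun f : hom A B => g ∘ f).
Proof. by move=> k f f'; apply: comp_linr. Qed.

Lemma comp0m A B C (f : hom A B) : (0 : hom B C) ∘ f = 0.
Proof. exact: linear_eq0 (comp_linear_l f). Qed.

Lemma compm0 A B C (g : hom B C) : g ∘ (0 : hom A B) = 0.
Proof. exact: linear_eq0 (comp_linear_r g). Qed.

Lemma compZl A B C k (g : hom B C) (f : hom A B) : (k *: g) ∘ f = k *: (g ∘ f).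
Proof. exact: linear_scale (comp_linear_l f) _ _. Qed.

Lemma compZr A B C k (g : hom B C) (f : hom A B) : g ∘ (k *: f) = k *: (g ∘ f).
Proof. exact: linear_scale (comp_linear_r g) _ _. Qed.

Lemma comp_suml A B C I r (P : pred I) (G : I -> hom B C) (f : hom A B) :
  (\sum_(i <- r | P i) G i) ∘ f = \sum_(i <- r | P i) G i ∘ f.
Proof. exact: (linear_bigsum (comp_linear_l f)). Qed.

Lemma comp_sumr A B C I r (P : pred I) (g : hom B C) (F : I -> hom A B) :
  g ∘ (\sum_(i <- r | P i) F i) = \sum_(i <- r | P i) g ∘ F i.
Proof. exact: (linear_bigsum (comp_linear_r g)). Qed.

Lemma dag0 A B : (0 : hom A B)^† = 0.
Proof.
have := dag_antilin (-1) (0 : hom A B) 0.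
by rewrite rmorphN rmorph1 !scaleN1r oppr0 !addr0 addNr.
Qed.

Lemma dag_idm A : (idm A)^† = idm A.
(* [id† = id†† ∘ id† = (id ∘ id†)† = id†† = id]. *)
Proof. by rewrite -[LHS]comp1m -{1}[idm A]dagK -dag_comp comp1m dagK. Qed.

Lemma simple_idm_neq0 A : simple A -> idm A != 0.
Proof.
rewrite /simple => A1; apply/eqP=> id0.
suff: (\dim {: hom A A} <= 0)%N by rewrite A1.
rewrite leqn0 dimv_eq0 -subv0; apply/subvP=> f _.
by rewrite memv0 -[f]comp1m id0 comp0m.
Qed.

Lemma simple_endo A (f : hom A A) : simple A -> exists c, f = c *: idm A.
Proof.
move=> A1; apply/vlineP; suff -> : (<[idm A]> = {: hom A A})%VS by rewrite memvf.
apply/eqP; rewrite eqEdim subvf dim_vline (simple_idm_neq0 A1).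
by rewrite /simple in A1; rewrite A1.
Qed.

Lemma scale_idm_inj A (c d : K) : simple A -> c *: idm A = d *: idm A -> c = d.
Proof.
move=> /simple_idm_neq0 A1 /eqP; rewrite -subr_eq0 -scalerBl scaler_eq0.
by rewrite (negPf A1) orbF subr_eq0 => /eqP.
Qed.

Lemma unitary_cancel_r A B C (u : hom A B) (f g : hom B C) :
  unitary u -> f ∘ u = g ∘ u -> f = g.
Proof.
by move=> [_ uu] fg; rewrite -[f]compm1 -[g]compm1 -uu !compA fg.
Qed.

End DaggerTheory.

(** * Schur's lemma and resolution of the identity by dual bases *)

Section UnitaryTheory.
Context (K : numClosedFieldType) (U : unitary_cat K) (I : irreducibles U).
Implicit Types A B : U.

(** If [f] is nonzero, the scalars [f^† ∘ f] and [f ∘ f^†] agree and are nonzero by definiteness.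
    Rescaling [f^†] then inverts [f], although distinct representatives are never isomorphic. *)
Lemma schur_eq0 (k k' : I) (f : hom (iob k) (iob k')) : k != k' -> f = 0.
Proof.
move=> kk'; apply/eqP; apply: contraT => f0.
have [c Ec] := simple_endo (f^† ∘ f) (iob_simple k).
have [c' Ec'] := simple_endo (f ∘ f^†) (iob_simple k').
have c0 : c != 0.
  apply: contra f0 => /eqP c0; apply/eqP/dag_definite.
  by rewrite Ec c0 scale0r.
(* Both scalars are read off from [f ∘ f^† ∘ f]. *)
have cc' : c = c'.
  have /eqP : c *: f = c' *: f.
    by rewrite -[in LHS](compm1 f) -compZr -Ec compA Ec' compZl comp1m.
  by rewrite -subr_eq0 -scalerBl scaler_eq0 (negPf f0) orbF subr_eq0 => /eqP.
case/negP: kk'; apply/eqP/iob_inj; exists f, (c^-1 *: f^†); split.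
  by rewrite compZl Ec scalerA mulVf ?scale1r.
by rewrite compZr Ec' scalerA cc' mulVf ?scale1r // -cc'.
Qed.

(** The number of vectors is already the dimension, and composing a linear relation with [pdual j]
    isolates its coefficient at [j]. *)
Lemma pbas_basis (k : I) A :
  basis_of fullv [tuple pbas i | i < \dim {: hom (iob k) A}].
Proof.
rewrite basisEfree size_tuple leqnn subvf !andbT; apply/freeP => c.
under eq_bigr => i _ do rewrite -tnth_nth tnth_mktuple.
move=> c0 j; have: pdual j ∘ \sum_i c i *: pbas i = c j *: idm (iob k).
  rewrite comp_sumr (bigD1 j) //= compZr pdualP eqxx big1 ?addr0 // => i ij.
  by rewrite compZr pdualP [j == i]eq_sym (negPf ij) scaler0.
rewrite c0 compm0 => /esym/eqP; rewrite scaler_eq0.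
by rewrite (negPf (simple_idm_neq0 (iob_simple k))) orbF => /eqP.
Qed.

Lemma pbas_expand (k : I) A (z : hom (iob k) A) :
  \sum_(p < \dim {: hom (iob k) A}) pbas p ∘ (pdual p ∘ z) = z.
Proof.
have [c ->] : exists c : 'I_(\dim {: hom (iob k) A}) -> K,
    z = \sum_i c i *: pbas i.
  exists (fun i => coord [tuple pbas i | i < _] i z).
  rewrite [LHS](coord_basis (pbas_basis k A) (memvf z)).
  by apply: eq_bigr => i _; rewrite -tnth_nth tnth_mktuple.
apply: eq_bigr => p _; rewrite comp_sumr (bigD1 p) //= big1 => [|i ip].
  by rewrite compZr pdualP eqxx addr0 compZr compm1.
by rewrite compZr pdualP [p == i]eq_sym (negPf ip) scaler0.
Qed.

(** A morphism [A -> k] vanishing on every [k -> A] is killed by its own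
    adjoint. *)
Lemma pdual_expand (k : I) A (y : hom A (iob k)) :
  \sum_(p < \dim {: hom (iob k) A}) (y ∘ pbas p) ∘ pdual p = y.
Proof.
apply/eqP; rewrite eq_sym -subr_eq0; set y' := (X in X == 0).
have y'0 (z : hom (iob k) A) : y' ∘ z = 0.
  rewrite /y' -scaleN1r addrC comp_linl scaleN1r comp_suml.
  under eq_bigr => p _ do rewrite -compA -compA.
  by rewrite -comp_sumr pbas_expand addNr.
rewrite -[y']dagK (dag_definite (f := y'^†)) ?dag0 //.
by rewrite dagK y'0.
Qed.

(** The sum fixes every morphism out of a representative: the block of that representative acts by
    [pbas_expand], and the others vanish by Schur's lemma. By semisimplicity such morphisms detect
    the identity of [A]. *)
Lemma pbas_complete A :
  \sum_(k : I) \sum_(p < \dim {: hom (iob k) A}) pbas p ∘ pdual p = idm A.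
Proof.
set e := LHS.
have e_simple (k : I) (z : hom (iob k) A) : e ∘ z = z.
  rewrite /e comp_suml (bigD1 k) //= comp_suml [X in _ + X]big1 => [|k' k'k].
    rewrite addr0 -[RHS]pbas_expand; apply: eq_bigr => p _.
    by rewrite compA.
  rewrite comp_suml big1 // => p _.
  by rewrite -compA [X in _ ∘ X]schur_eq0 ?compm0 // eq_sym.
have [n [F [j [F1 [_ _ jj]]]]] := semisimple A.
rewrite -[e]compm1 -[in LHS]jj comp_sumr -[RHS]jj; apply: eq_bigr => t _.
have [x [f [g [gf fg]]]] := iob_surj I (F1 t).
by rewrite compA -[j t]compm1 -gf (compA (j t)) compA e_simple.
Qed.

(** [\sum_q q ⊗ q^*] is the canonical element of [hom k A ⊗ hom A k]. *)
Lemma dual_bases_transfer (V : lmodType K) (k : I) A B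
    (G : hom (iob k) B -> hom A (iob k) -> V) x y :
  is_bilinear G ->
  G x y = \sum_(q < \dim {: hom (iob k) A}) G (x ∘ y ∘ pbas q) (pdual q).
Proof.
move=> [Gl Gr]; rewrite -[in LHS](pdual_expand y) (linear_bigsum (Gr _)).
apply: eq_bigr => q _; rewrite -[x ∘ y ∘ _]compA.
have [c ->] := simple_endo (y ∘ pbas q) (iob_simple k).
rewrite compZl comp1m compZr compm1.
by rewrite (linear_scale (Gl _)) (linear_scale (Gr _)).
Qed.

Lemma delta_refl (x : I) : delta x x = idm (iob x).
Proof. by rewrite /delta; case: eqP => // e; rewrite eq_axiomK. Qed.

Lemma delta_neq (x y : I) : x != y -> delta x y = 0.
Proof. by rewrite /delta; case: eqP. Qed.

End UnitaryTheory.

(** * Action of endomorphisms of the tensor unit on objects *)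

Section UnitAction.
Context (K : numClosedFieldType).

(** Applied to the projections onto the summands of the unit, this splits [A] according to the unit
    summand on its left. *)
Definition unit_action (C : monoidal_cat K) (e : hom (𝟙 C) (𝟙 C)) (A : C) :
  hom A A := lunit A ∘ (e ⊗m idm A) ∘ (lunit A)^†.

Lemma unit_action_linear (C : monoidal_cat K) (A : C) :
  linear (fun e : hom (𝟙 C) (𝟙 C) => unit_action e A).
Proof.
move=> k e e'.
by rewrite /unit_action tenm_linl (comp_linear_r _) (comp_linear_l _).
Qed.

Lemma unit_action_id (C : monoidal_cat K) (A : C) :
  unit_action (idm (𝟙 C)) A = idm A.
Proof. by rewrite /unit_action tenm_id compm1 (lunit_unitary A).2. Qed.

Lemma unit_action_comp (C : monoidal_cat K) (A : C) (e e' : hom (𝟙 C) (𝟙 C)) :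
  unit_action e A ∘ unit_action e' A = unit_action (e ∘ e') A.
Proof.
rewrite /unit_action -!compA (compA (_^†)) (lunit_unitary A).1 comp1m.
by rewrite (compA (e ⊗m _)) -tenm_comp comp1m.
Qed.

Context (C D : monoidal_cat K) (M : bimodule_cat C D).

Lemma lactm_compl (A A' A'' : C) (X : M) (f' : hom A' A'') (f : hom A A') :
  (f' ∘ f) ⊳m idm X = (f' ⊳m idm X) ∘ (f ⊳m idm X).
Proof. by rewrite -lactm_comp comp1m. Qed.

Lemma lactm_compr (A : C) (X X' X'' : M) (g' : hom X' X'') (g : hom X X') :
  idm A ⊳m (g' ∘ g) = (idm A ⊳m g') ∘ (idm A ⊳m g).
Proof. by rewrite -lactm_comp comp1m. Qed.

Lemma ractm_compl (B : D) (X X' X'' : M) (g' : hom X' X'') (g : hom X X') :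
  (g' ∘ g) ⊲m idm B = (g' ⊲m idm B) ∘ (g ⊲m idm B).
Proof. by rewrite -ractm_comp comp1m. Qed.

Lemma ractm_compr (X : M) (B B' B'' : D) (f' : hom B' B'') (f : hom B B') :
  idm X ⊲m (f' ∘ f) = (idm X ⊲m f') ∘ (idm X ⊲m f).
Proof. by rewrite -ractm_comp comp1m. Qed.

Lemma lactm_linear_l (A A' : C) (X X' : M) (g : hom X X') :
  linear (fun f : hom A A' => f ⊳m g).
Proof. by move=> k f f'; apply: lactm_linl. Qed.

Lemma ractm_linear_l (B B' : D) (X X' : M) (f : hom B B') :
  linear (fun g : hom X X' => g ⊲m f).
Proof. by move=> k g g'; apply: ractm_linl. Qed.

Lemma ractm_linear_r (B B' : D) (X X' : M) (g : hom X X') :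
  linear (fun f : hom B B' => g ⊲m f).
Proof. by move=> k f f'; apply: ractm_linr. Qed.

(** Locked, so that rewriting with [compA] does not unfold them into composites. *)
Definition lproj (e : hom (𝟙 C) (𝟙 C)) (X : M) : hom X X :=
  locked (lunitor X ∘ (e ⊳m idm X) ∘ (lunitor X)^†).

Definition rproj (e : hom (𝟙 D) (𝟙 D)) (X : M) : hom X X :=
  locked (runitor X ∘ (idm X ⊲m e) ∘ (runitor X)^†).

Lemma lunitor_dag_nat (X X' : M) (g : hom X X') :
  (lunitor X')^† ∘ g = (idm _ ⊳m g) ∘ (lunitor X)^†.
Proof.
have := congr1 (fun h => h^†) (lunitor_nat g^†).
by rewrite /= !dag_comp lactm_dag dagK dag_idm => ->.
Qed.

Lemma runitor_dag_nat (X X' : M) (g : hom X X') :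
  (runitor X')^† ∘ g = (g ⊲m idm _) ∘ (runitor X)^†.
Proof.
have := congr1 (fun h => h^†) (runitor_nat g^†).
by rewrite /= !dag_comp ractm_dag dagK dag_idm => ->.
Qed.

(** Naturality lets a unit strand next to the wall slide through any vertex; the later relocations
    of scalars rest on this and on [rproj_nat]. *)
Lemma lproj_nat e (X X' : M) (g : hom X X') : lproj e X' ∘ g = g ∘ lproj e X.
Proof.
rewrite /lproj -!lock -compA lunitor_dag_nat !compA -lunitor_nat.
by congr (_ ∘ _); rewrite -!compA -!lactm_comp !comp1m !compm1.
Qed.

Lemma rproj_nat e (X X' : M) (g : hom X X') : rproj e X' ∘ g = g ∘ rproj e X.
Proof.
rewrite /rproj -!lock -compA runitor_dag_nat !compA -runitor_nat.
by congr (_ ∘ _); rewrite -!compA -!ractm_comp !comp1m !compm1.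
Qed.

(** Kelly's argument: the identity holds after acting with the unit, by the
    pentagon and the two triangles, and that action is faithful. *)
Lemma lunitor_lact (A : C) (X : M) :
  lunitor (A ⊳ X) ∘ lassoc (𝟙 C) A X = lunit A ⊳m idm X.
Proof.
apply: (unitary_cancel_r (lunitor_unitary ((𝟙 C ⊗ A) ⊳ X))).
rewrite -!lunitor_nat; congr (_ ∘ _).
apply: (unitary_cancel_r (lassoc_unitary (𝟙 C) (𝟙 C ⊗ A) X)).
have assocX_unitary : unitary (assoc (𝟙 C) (𝟙 C) A ⊳m idm X).
  have [a1 a2] := assoc_unitary (𝟙 C) (𝟙 C) A.
  by split; rewrite lactm_dag dag_idm -lactm_comp ?a1 ?a2 comp1m lactm_id.
apply: (unitary_cancel_r assocX_unitary).
rewrite lactm_compr -!compA [X in _ ∘ X = _]compA -lpentagon !compA ltriangle.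
rewrite -lactm_id -!lassoc_nat -triangle -!compA; congr (_ ∘ _).
by rewrite -lactm_compl.
Qed.

(** A unit strand to the left of [A ⊳ X] acts on [A] alone, since [lunitor_lact] expresses the
    unitor of [A ⊳ X] through that of [A]. *)
Lemma lproj_lact e (A : C) (X : M) :
  lproj e (A ⊳ X) = unit_action e A ⊳m idm X.
Proof.
have lunitorE : lunitor (A ⊳ X) = (lunit A ⊳m idm X) ∘ (lassoc (𝟙 C) A X)^†.
  by rewrite -lunitor_lact -compA (lassoc_unitary _ _ _).2 compm1.
rewrite /lproj -!lock lunitorE dag_comp dagK lactm_dag dag_idm -lactm_id.
rewrite -!compA (compA (e ⊳m _)) -lassoc_nat !compA.
rewrite -[_ ∘ _^† ∘ lassoc _ _ _]compA (lassoc_unitary _ _ _).1 compm1.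
by rewrite -!lactm_comp !comp1m.
Qed.

(** The triangle axiom turns a unit strand on the right of [X] into one on the left of [B]. *)
Lemma rproj_ract e (X : M) (B : D) :
  rproj e X ⊲m idm B = idm X ⊲m unit_action e B.
Proof.
rewrite /rproj -!lock !ractm_compl.
have -> : (runitor X)^† ⊲m idm B = (runitor X ⊲m idm B)^†.
  by rewrite ractm_dag dag_idm.
rewrite -rtriangle dag_comp ractm_dag dag_idm.
rewrite -!compA (compA (rassoc _ _ _)) rassoc_nat -!compA.
rewrite (compA (rassoc _ _ _)) (rassoc_unitary _ _ _).2 comp1m.
by rewrite -!ractm_comp !comp1m compA.
Qed.

End UnitAction.

(** * Tube diagrams as a spanning set, and bilinearity of the operations on them *)

Section TubeTheory.
Context (K : numClosedFieldType) (C D : multifusion K) (M : bimodule_cat C D).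
Context (IC : multifusion_irr C) (ID : multifusion_irr D) (IM : irreducibles M).
Local Notation lbl := (lbl IC ID IM).
Local Notation tube := (tube IC ID IM).
Implicit Types (l r : lbl).

Lemma tube_inj_linear l : linear (@tube_inj _ _ _ _ IC ID IM l).
Proof.
move=> k x y; apply/ffunP=> t; rewrite !ffunE.
have [e|ne] := eqVneq (tag t) l; last first.
  by rewrite !untag_dflt // addr0 scaler0.
by rewrite !untagE !mxE.
Qed.

Lemma tube_proj_linear l : linear (tube_proj l : tube -> _).
Proof. by move=> k x y; apply/matrixP=> i j; rewrite !mxE !ffunE. Qed.

Lemma tube_injE l (x : tensor (low l) (upp l)) i j :
  tube_inj x (Tagged _ (i, j)) = x i j.
Proof.
by rewrite ffunE; apply: (untagE _ _ (erefl (tag (existT _ l (i, j))))).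
Qed.

Lemma tube_injK l : cancel (@tube_inj _ _ _ _ IC ID IM l) (tube_proj l).
Proof.
by move=> x; apply/matrixP=> i j; rewrite mxE tube_injE.
Qed.

Lemma tube_proj_inj l l' (x : tensor (low l) (upp l)) :
  l != l' -> tube_proj l' (tube_inj x) = 0.
Proof.
move=> ll'; apply/matrixP=> i j.
by rewrite !mxE ffunE untag_dflt //= eq_sym.
Qed.

Lemma tube_expand (x : tube) : x = \sum_l tube_inj (tube_proj l x).
Proof.
apply/ffunP=> -[l [i j]]; rewrite sum_ffunE (bigD1 l) //= big1 => [|l' l'l].
  by rewrite addr0 tube_injE mxE.
by rewrite ffunE untag_dflt //= eq_sym.
Qed.

Lemma diagram_bilinear l : is_bilinear (@diagram _ _ _ _ IC ID IM l).
Proof.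
split=> [w|v] k x y.
  by rewrite /diagram (tpure_bilinear _ _).1 tube_inj_linear.
by rewrite /diagram (tpure_bilinear _ _).2 tube_inj_linear.
Qed.

Lemma tube_ind (P : tube -> Prop) :
    (forall k x y, P x -> P y -> P (k *: x + y)) -> P 0 ->
    (forall l (v : low l) (w : upp l), P (diagram v w)) ->
  forall x, P x.
Proof.
move=> PL P0 Pdiag x; rewrite (tube_expand x).
apply: (big_ind P) => // [y z Py Pz|l _].
  by rewrite -[y]scale1r; apply: PL.
apply: (tensor_ind (P := fun y => P (tube_inj y))) => [k y z Py Pz||v w].
- by rewrite tube_inj_linear; apply: PL.
- by rewrite (linear_eq0 (@tube_inj_linear l)).
exact: Pdiag.
Qed.

Lemma tube_lift_linear (V : vectType K) (F : forall l, low l -> upp l -> V) :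
  linear (tube_lift F : tube -> V).
Proof.
move=> k x y; rewrite /tube_lift scaler_sumr -big_split.
by apply: eq_bigr => l _ /=; rewrite tube_proj_linear tlift_linear.
Qed.

(** Linearity in the family instead of the tube: nested lifts such as [join] need it for their inner
    argument. *)
Lemma tube_lift_linear_fun (V : vectType K)
    (F F' F'' : forall l, low l -> upp l -> V) k (x : tube) :
    (forall l v w, F l v w = k *: F' l v w + F'' l v w) ->
  tube_lift F x = k *: tube_lift F' x + tube_lift F'' x.
Proof.
move=> FE; rewrite /tube_lift scaler_sumr -big_split; apply: eq_bigr => l _ /=.
rewrite /tlift scaler_sumr -big_split; apply: eq_bigr => i _ /=.
rewrite scaler_sumr -big_split; apply: eq_bigr => j _ /=.
by rewrite FE scalerDr !scalerA mulrC.
Qed.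

Lemma tube_lift_diagram (V : vectType K) (F : forall l, low l -> upp l -> V) l
    (v : low l) (w : upp l) :
  is_bilinear (F l) -> tube_lift F (diagram v w) = F l v w.
Proof.
move=> Fbil; rewrite /tube_lift (bigD1 l) //= big1 => [|l' l'l].
  by rewrite addr0 tube_injK tlift_pure.
rewrite tube_proj_inj 1?eq_sym //.
exact: linear_eq0 (tlift_linear _).
Qed.

Lemma mu_of_linear l : linear (@mu_of _ _ _ _ IC ID IM l).
Proof. by move=> k v v'; rewrite /mu_of (comp_linear_r _). Qed.

Lemma nu_of_linear l : linear (@nu_of _ _ _ _ IC ID IM l).
Proof. by move=> k v v'; rewrite /nu_of (comp_linear_r _). Qed.

Lemma gamma_of_linear l : linear (@gamma_of _ _ _ _ IC ID IM l).
Proof. by move=> k w w'; rewrite /gamma_of (comp_linear_l _). Qed.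

Lemma zeta_of_linear l : linear (@zeta_of _ _ _ _ IC ID IM l).
Proof. by move=> k w w'; rewrite /zeta_of !comp_linl. Qed.

Lemma diagram_join_bilinear_l r l (vl : low l) (wl : upp l) :
  is_bilinear (fun (vr : low r) (wr : upp r) => diagram_join vr wr vl wl).
Proof.
split=> [wr|vr] k x y.
  by rewrite /diagram_join mu_of_linear comp_linr (diagram_bilinear _).1.
by rewrite /diagram_join gamma_of_linear comp_linl (diagram_bilinear _).2.
Qed.

Lemma diagram_join_bilinear_r r l (vr : low r) (wr : upp r) :
  is_bilinear (fun (vl : low l) (wl : upp l) => diagram_join vr wr vl wl).
Proof.
split=> [wl|vl] k x y; rewrite /diagram_join.
  by rewrite nu_of_linear comp_linl ractm_linl comp_linl (diagram_bilinear _).1.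
by rewrite zeta_of_linear comp_linr ractm_linl comp_linr (diagram_bilinear _).2.
Qed.

Lemma join_bilinear : is_bilinear (@join _ _ _ _ IC ID IM).
Proof.
split=> [y|x] k u v; first exact: tube_lift_linear.
apply: tube_lift_linear_fun => l vr wr; exact: tube_lift_linear.
Qed.

Lemma join_diagram r l (vr : low r) (wr : upp r) (vl : low l) (wl : upp l) :
  join (diagram vr wr) (diagram vl wl) = diagram_join vr wr vl wl.
Proof.
rewrite /join tube_lift_diagram.
  by rewrite tube_lift_diagram //; apply: diagram_join_bilinear_r.
by split=> [w|v] k x y; apply: tube_lift_linear_fun => l' v' w';
  [ apply: (diagram_join_bilinear_l _ _ _).1
  | apply: (diagram_join_bilinear_l _ _ _).2].
Qed.

Lemma join2_bilinear : is_bilinear (@join2 _ _ _ _ IC ID IM).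
Proof.
split=> [y|x] k u v; first exact: tlift_linear.
rewrite /join2 {1 3 4}/tlift scaler_sumr -big_split; apply: eq_bigr => i _ /=.
rewrite scaler_sumr -big_split; apply: eq_bigr => j _ /=.
by rewrite tlift_linear scalerDr !scalerA mulrC.
Qed.

Lemma join2_suml I (s : seq I) (P : pred I) F (y : tensor tube tube) :
  join2 (\sum_(i <- s | P i) F i) y = \sum_(i <- s | P i) join2 (F i) y.
Proof. exact: (linear_bigsum (join2_bilinear.1 y)). Qed.

Lemma join2_sumr I (s : seq I) (P : pred I) F (x : tensor tube tube) :
  join2 x (\sum_(i <- s | P i) F i) = \sum_(i <- s | P i) join2 x (F i).
Proof. exact: (linear_bigsum (join2_bilinear.2 x)). Qed.

Lemma join2_pure (r1 r2 l1 l2 : tube) :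
  join2 (tpure r1 r2) (tpure l1 l2) = tpure (join r1 l1) (join r2 l2).
Proof.
have jbl (r r' : tube) :
    is_bilinear (fun l l' : tube => tpure (join r l) (join r' l')).
  by apply: bilinear_tpure; apply: join_bilinear.2.
rewrite /join2 tlift_pure; first by rewrite tlift_pure.
split=> [r'|r] k x y; rewrite [in LHS]/tlift [in RHS]/tlift scaler_sumr -big_split;
  apply: eq_bigr => i _ /=; rewrite scaler_sumr -big_split;
  apply: eq_bigr => j _ /=.
  by rewrite join_bilinear.1 (tpure_bilinear _ _).1 scalerDr !scalerA mulrC.
by rewrite join_bilinear.1 (tpure_bilinear _ _).2 scalerDr !scalerA mulrC.
Qed.

Lemma tube_comul_linear : linear (@tube_comul _ _ _ _ IC ID IM).
Proof. exact: tube_lift_linear. Qed.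

Lemma tube_comul_diagram l (v : low l) (w : upp l) :
  tube_comul (diagram v w) = \sum_(i : IM) \sum_(k : IM)
    \sum_(p < \dim {: hom (iob k) (iob (la l) ⊳ iob i ⊲ iob (lb l))})
      tpure (diagram (l := Label (la l) (lb l) k i (lf l) (lh l)) (pbas p) w)
            (diagram (l := Label (la l) (lb l) (lc l) (le l) i k) v (pdual p)).
Proof.
rewrite /tube_comul tube_lift_diagram //; split=> [w'|v'] c x y.
  rewrite scaler_sumr -big_split; apply: eq_bigr => i _ /=.
  rewrite scaler_sumr -big_split; apply: eq_bigr => k _ /=.
  rewrite scaler_sumr -big_split; apply: eq_bigr => p _ /=.
  by rewrite (diagram_bilinear _).1 (tpure_bilinear _ _).2.
rewrite scaler_sumr -big_split; apply: eq_bigr => i _ /=.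
rewrite scaler_sumr -big_split; apply: eq_bigr => k _ /=.
rewrite scaler_sumr -big_split; apply: eq_bigr => p _ /=.
by rewrite (diagram_bilinear _).2 (tpure_bilinear _ _).1.
Qed.

End TubeTheory.

(** * Compatibility of the coproduct with [⋈] *)

Section JoinComultiplication.
Context (K : numClosedFieldType) (C D : multifusion K) (M : bimodule_cat C D).
Context (IC : multifusion_irr C) (ID : multifusion_irr D) (IM : irreducibles M).
Local Notation lbl := (lbl IC ID IM).
Implicit Types (l r : lbl).

Lemma uincl_usum (E : multifusion K) (IE : multifusion_irr E) (i : ucomp IE) :
  uincl (usum i) = uinc i.
Proof.
rewrite /uincl (bigD1 i) //= delta_refl compm1 big1 ?addr0 // => j ji.
by rewrite delta_neq ?compm0 // (inj_eq (@usum_inj _ _ IE)) eq_sym.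
Qed.

(** The projection of the unit onto its summand [a], or [0] when [a] is not a chosen summand; this
    treats all labels uniformly. *)
Definition usupp (E : multifusion K) (IE : multifusion_irr E) (a : IE) :
  hom (𝟙 E) (𝟙 E) := uincl a ∘ (uincl a)^†.

Lemma usupp_uincl (E : multifusion K) (IE : multifusion_irr E) (a : IE) :
  usupp a ∘ uincl a = uincl a.
Proof.
rewrite /usupp -compA.
have [/codomP[i ->]|a_notin] := boolP (a \in codom (@usum _ _ IE)).
  by rewrite uincl_usum; have [-> _ _] := uincP IE; rewrite compm1.
suff -> : uincl a = 0 by rewrite !comp0m.
rewrite /uincl big1 // => i _; rewrite delta_neq ?compm0 //.
by apply: contraNneq a_notin => ->; apply: codom_f.
Qed.

(** A partial isometry removing a unit strand, whose dagger reinserts it. It is locked, like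
    [lproj], to remain a single factor under [compA]. *)
Definition erase_l (a : IC) (X : M) (B : D) : hom (iob a ⊳ X ⊲ B) (X ⊲ B) :=
  locked ((lunitor X ∘ (uincl a ⊳m idm X)) ⊲m idm B).

Definition erase_r (b : ID) (X : M) : hom (X ⊲ iob b) X :=
  locked (runitor X ∘ (idm X ⊲m uincl b)).

Lemma mu_ofE l (v : low l) : mu_of v = erase_l _ _ _ ∘ v.
Proof. by rewrite /erase_l -lock. Qed.

Lemma nu_ofE l (v : low l) : nu_of v = erase_r _ _ ∘ v.
Proof. by rewrite /erase_r -lock. Qed.

Lemma gamma_ofE l (w : upp l) : gamma_of w = w ∘ (erase_l _ _ _)^†.
Proof. by rewrite /erase_l -!lock ractm_dag dag_comp lactm_dag !dag_idm. Qed.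

Lemma zeta_ofE l (w : upp l) : zeta_of w = w ∘ (erase_r _ _)^†.
Proof. by rewrite /erase_r -!lock dag_comp ractm_dag dag_idm compA. Qed.

Lemma erase_l_coisometry (a : IC) (X : M) (B : D) :
  erase_l a X B ∘ (erase_l a X B)^† = lproj (usupp a) X ⊲m idm B.
Proof.
rewrite /erase_l -!lock ractm_dag dag_idm -ractm_compl dag_comp lactm_dag dag_idm.
by rewrite /lproj -lock /usupp lactm_compl !compA.
Qed.

Lemma erase_r_coisometry (b : ID) (X : M) :
  erase_r b X ∘ (erase_r b X)^† = rproj (usupp b) X.
Proof.
rewrite /erase_r -!lock dag_comp ractm_dag dag_idm.
by rewrite /rproj -lock /usupp ractm_compr !compA.
Qed.

Lemma lproj_erase_l (a : IC) (X : M) (B : D) :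
  (lproj (usupp a) X ⊲m idm B) ∘ erase_l a X B = erase_l a X B.
Proof.
rewrite /erase_l -!lock -ractm_compl; congr (_ ⊲m _).
rewrite /lproj -lock -!compA (compA (_^†)) (lunitor_unitary _).1 comp1m.
by rewrite -lactm_compl usupp_uincl.
Qed.

Lemma rproj_erase_r (b : ID) (X : M) :
  rproj (usupp b) X ∘ erase_r b X = erase_r b X.
Proof.
rewrite /erase_r /rproj -!lock -!compA (compA (_^†)) (runitor_unitary _).1 comp1m.
by rewrite -ractm_compr usupp_uincl.
Qed.

Section JoinDiagrams.
Context (r l : lbl) (s t : K).
Hypothesis sP : unit_action (usupp (la r)) (iob (la l)) = s *: idm _.
Hypothesis tP : unit_action (usupp (lb l)) (iob (lb r)) = t *: idm _.

Lemma lproj_lact_scale (X : M) :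
  lproj (usupp (la r)) (iob (la l) ⊳ X) = s *: idm _.
Proof.
by rewrite lproj_lact sP (linear_scale (lactm_linear_l _)) lactm_id.
Qed.

Lemma rproj_ract_scale (X : M) :
  rproj (usupp (lb l)) X ⊲m idm (iob (lb r)) = t *: idm _.
Proof.
by rewrite rproj_ract tP (linear_scale (ractm_linear_r _)) ractm_id.
Qed.

(** The projection belonging to the strand erased from [vr] fixes [V]; sliding up through [f], it
    reaches [la l] and becomes [s]. The one belonging to [vl] slides down below [f] and becomes [t]
    on [lb r]. *)
Lemma join_low_scale (vr : low r) (vl : low l) :
  let V := ((nu_of vl ∘ delta (le r) (lc l)) ⊲m idm (iob (lb r))) ∘ mu_of vr in
  V = (s * t) *: V.
Proof.
set f := nu_of vl ∘ _; move=> V.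
have Vs : V = s *: V.
  rewrite {1}/V mu_ofE -lproj_erase_l -compA -mu_ofE compA -ractm_compl.
  rewrite -lproj_nat lproj_lact_scale.
  by rewrite compZl comp1m (linear_scale (ractm_linear_l _)) compZl.
have Vt : V = t *: V.
  have fE : f = f ∘ rproj (usupp (lb l)) (iob (le r)).
    by rewrite -rproj_nat /f nu_ofE 2!(compA (rproj _ _)) rproj_erase_r.
  rewrite {1}/V fE ractm_compl rproj_ract_scale.
  by rewrite compZr compm1 compZl.
by rewrite -scalerA -Vt.
Qed.

(** With [join_pdual], this is the family [x_t], [y_t]: the vertices obtained when terms of the two
    coproducts are joined. *)
Definition join_pbas (k i i' k' : IM)
    (p : 'I_(\dim {: hom (iob k) (iob (la r) ⊳ iob i ⊲ iob (lb r))}))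
    (p' : 'I_(\dim {: hom (iob k') (iob (la l) ⊳ iob i' ⊲ iob (lb l))})) :
    hom (iob k) (iob (la l) ⊳ iob i' ⊲ iob (lb r)) :=
  ((erase_r _ _ ∘ pbas p' ∘ delta i k') ⊲m idm _) ∘ (erase_l _ _ _ ∘ pbas p).

Definition join_pdual (k i i' k' : IM)
    (p : 'I_(\dim {: hom (iob k) (iob (la r) ⊳ iob i ⊲ iob (lb r))}))
    (p' : 'I_(\dim {: hom (iob k') (iob (la l) ⊳ iob i' ⊲ iob (lb l))})) :
    hom (iob (la l) ⊳ iob i' ⊲ iob (lb r)) (iob k) :=
  pdual p ∘ (erase_l _ _ _)^†
    ∘ ((delta k' i ∘ (pdual p' ∘ (erase_r _ _)^†)) ⊲m idm _).

Lemma join_pbasE (k i i' k' : IM)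
    (p : 'I_(\dim {: hom (iob k) (iob (la r) ⊳ iob i ⊲ iob (lb r))}))
    (p' : 'I_(\dim {: hom (iob k') (iob (la l) ⊳ iob i' ⊲ iob (lb l))})) :
  join_pbas p p' =
  ((nu_of (l := Label (la l) (lb l) k' i' (lf l) (lh l)) (pbas p')
      ∘ delta i k') ⊲m idm _)
    ∘ mu_of (l := Label (la r) (lb r) k i (lf r) (lh r)) (pbas p).
Proof. by rewrite mu_ofE nu_ofE. Qed.

Lemma join_pdualE (k i i' k' : IM)
    (p : 'I_(\dim {: hom (iob k) (iob (la r) ⊳ iob i ⊲ iob (lb r))}))
    (p' : 'I_(\dim {: hom (iob k') (iob (la l) ⊳ iob i' ⊲ iob (lb l))})) :
  join_pdual p p' =
  gamma_of (l := Label (la r) (lb r) (lc r) (le r) i k) (pdual p)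
    ∘ ((delta k' i ∘ zeta_of (l := Label (la l) (lb l) (lc l) (le l) i' k')
         (pdual p')) ⊲m idm _).
Proof. by rewrite gamma_ofE zeta_ofE. Qed.

(** The [p'] run over a complete resolution of an identity, but the [p] only over maps from one
    fixed [k]. Hence the sum is evaluated on morphisms [z] out of [k]. *)
Lemma join_pbas_pdual_sum (k i' : IM)
    (z : hom (iob k) (iob (la l) ⊳ iob i' ⊲ iob (lb r))) :
  (\sum_(i : IM)
   \sum_(p < \dim {: hom (iob k) (iob (la r) ⊳ iob i ⊲ iob (lb r))})
   \sum_(k' : IM)
   \sum_(p' < \dim {: hom (iob k') (iob (la l) ⊳ iob i' ⊲ iob (lb l))})
     join_pbas p p' ∘ join_pdual p p') ∘ z = (s * t) *: z.
Proof.
set A := iob (la l) ⊳ iob i'; set er := erase_r (lb l) A.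
set e := usupp (la r).
transitivity (((lproj e A ∘ (er ∘ (\sum_(i : IM)
  \sum_(p' < \dim {: hom (iob i) (A ⊲ iob (lb l))}) pbas p' ∘ pdual p') ∘ er^†))
    ⊲m idm (iob (lb r))) ∘ z); last first.
  rewrite pbas_complete compm1 erase_r_coisometry lproj_lact_scale compZl comp1m.
  rewrite (linear_scale (ractm_linear_l _)) rproj_ract_scale scalerA.
  by rewrite compZl comp1m.
rewrite (comp_sumr _ _ er) comp_suml comp_sumr (linear_bigsum (ractm_linear_l _)).
rewrite !comp_suml; apply: eq_bigr => i _.
rewrite exchange_big (bigD1 i) //= [X in _ + X]big1 => [|k' k'i]; last first.
  apply: big1 => p _; apply: big1 => p' _.
  rewrite /join_pbas delta_neq 1?eq_sym // compm0.
  by rewrite (linear_eq0 (ractm_linear_l _)) !comp0m.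
rewrite addr0 exchange_big (comp_sumr _ _ er) comp_suml comp_sumr.
rewrite (linear_bigsum (ractm_linear_l _)) !comp_suml; apply: eq_bigr => p' _ /=.
(* [lproj] slides between [pbas p'] and [pdual p'], where it acts on [iob i] and splits into
   [erase_l] and its dagger. The sum over [p] is then inserted by expanding the map out of [k] that
   follows this dagger. *)
rewrite !compA lproj_nat -(compA er) lproj_nat !compA.
rewrite !ractm_compl -erase_l_coisometry -!compA.
rewrite -[in RHS](pbas_expand (_^† ∘ _)) !comp_sumr comp_suml.
apply: eq_bigr => p _.
by rewrite /join_pbas /join_pdual delta_refl comp1m compm1 !ractm_compl -!compA.
Qed.

End JoinDiagrams.

(** The scalar absorbed by [V] is moved across the tensor product onto the basis vectors of the
    first factor, where it equals the sum of the [x_t ∘ y_t]. Then [dual_bases_transfer] trades the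
    original dual bases for the pairs [x_t], [y_t]. *)
Lemma tube_comul_join_diagram r l (vr : low r) (wr : upp r) (vl : low l)
    (wl : upp l) :
  tube_comul (join (diagram vr wr) (diagram vl wl)) =
  join2 (tube_comul (diagram vr wr)) (tube_comul (diagram vl wl)).
Proof.
have [s sP] :=
  simple_endo (unit_action (usupp (la r)) (iob (la l))) (iob_simple _).
have [t tP] :=
  simple_endo (unit_action (usupp (lb l)) (iob (lb r))) (iob_simple _).
rewrite join_diagram /diagram_join.
set V := (_ ⊲m _) ∘ _; set W := gamma_of wr ∘ _.
have VE : V = (s * t) *: V by apply: join_low_scale.
rewrite !tube_comul_diagram /=.
(* A coproduct term of [diagram V W] with arbitrary morphisms in place of a dual pair. *)
pose G k i' (x : hom (iob k) (iob (la l) ⊳ iob i' ⊲ iob (lb r)))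
            (y : hom (iob (la l) ⊳ iob i' ⊲ iob (lb r)) (iob k)) :=
  tpure (diagram (l := Label (la l) (lb r) k i' (lf l) (lh r)) x W)
        (diagram (l := Label (la l) (lb r) (lc r) (le l) i' k) V y).
have Gbil k i' : is_bilinear (@G k i').
  have [dl _] := diagram_bilinear (Label (la l) (lb r) k i' (lf l) (lh r)).
  have [_ dr] := diagram_bilinear (Label (la l) (lb r) (lc r) (le l) i' k).
  exact: bilinear_tpure (dl W) (dr V).
transitivity (\sum_(i' : IM) \sum_(k : IM) \sum_(i : IM)
  \sum_(p < \dim {: hom (iob k) (iob (la r) ⊳ iob i ⊲ iob (lb r))})
  \sum_(k' : IM)
  \sum_(p' < \dim {: hom (iob k') (iob (la l) ⊳ iob i' ⊲ iob (lb l))})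
    G k i' (join_pbas p p') (join_pdual p p')); last first.
  under [LHS]eq_bigr => i' _ do rewrite exchange_big.
  rewrite exchange_big join2_suml; apply: eq_bigr => i _.
  rewrite exchange_big join2_suml; apply: eq_bigr => k _.
  rewrite exchange_big join2_suml; apply: eq_bigr => p _.
  rewrite join2_sumr; apply: eq_bigr => i' _.
  rewrite join2_sumr; apply: eq_bigr => k' _.
  rewrite join2_sumr; apply: eq_bigr => p' _.
  by rewrite join2_pure !join_diagram /G join_pbasE join_pdualE.
apply: eq_bigr => i' _; apply: eq_bigr => k _.
(* [L] applies [z] to the first half of the canonical element; at [x ∘ y] it returns [G x y]. *)
pose L z := \sum_(q < \dim {: hom (iob k) (iob (la l) ⊳ iob i' ⊲ iob (lb r))})
  G k i' (z ∘ pbas q) (pdual q).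
have LL : linear L.
  move=> c z z'; rewrite /L scaler_sumr -big_split; apply: eq_bigr => q _ /=.
  by rewrite comp_linl (Gbil _ _).1.
transitivity (L (\sum_(i : IM)
  \sum_(p < \dim {: hom (iob k) (iob (la r) ⊳ iob i ⊲ iob (lb r))})
  \sum_(k' : IM)
  \sum_(p' < \dim {: hom (iob k') (iob (la l) ⊳ iob i' ⊲ iob (lb l))})
    join_pbas p p' ∘ join_pdual p p')); last first.
  do 4!(rewrite (linear_bigsum LL); apply: eq_bigr => ? _).
  exact/esym/dual_bases_transfer.
apply: eq_bigr => q _.
rewrite (join_pbas_pdual_sum sP tP) (linear_scale ((Gbil _ _).1 _)).
(* [V] in the second factor supplies the scalar that the first factor has produced on the other
   side. *)
rewrite /G [in LHS]VE (linear_scale ((diagram_bilinear _).1 _)).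
by rewrite (linear_scale ((tpure_bilinear _ _).2 _)).
Qed.

Lemma tube_comul_join (x y : tube IC ID IM) :
  tube_comul (join x y) = join2 (tube_comul x) (tube_comul y).
Proof.
have jl := join_bilinear IC ID IM; have j2 := join2_bilinear IC ID IM.
have dL : linear (@tube_comul _ _ _ _ IC ID IM) by apply: tube_comul_linear.
move: x y; apply: tube_ind => [k x x' IH IH' y|y|r vr wr].
- by rewrite jl.1 !dL j2.1 IH IH'.
- by rewrite (linear_eq0 (jl.1 _)) (linear_eq0 dL) (linear_eq0 (j2.1 _)).
apply: tube_ind => [k y y' IH IH'||l vl wl].
- by rewrite jl.2 !dL j2.2 IH IH'.
- by rewrite (linear_eq0 (jl.2 _)) (linear_eq0 dL) (linear_eq0 (j2.2 _)).
exact: tube_comul_join_diagram.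
Qed.

End JoinComultiplication.

(** * The crossed product fills the tube algebra; transport of structure *)

Section CrossedProduct.
Context (K : numClosedFieldType) (C D : multifusion K) (M : bimodule_cat C D).
Context (IC : multifusion_irr C) (ID : multifusion_irr D) (IM : irreducibles M).
Local Notation lbl := (lbl IC ID IM).
Implicit Types (l r : lbl).

(** The unit summands act by idempotents with sum the identity, so one of them acts by a nonzero
    scalar, which idempotence forces to be [1]. *)
Lemma simple_unit_summand (E : multifusion K) (IE : multifusion_irr E) (A : E) :
  simple A -> exists i : ucomp IE, unit_action (usupp (usum i)) A = idm A.
Proof.
move=> A1.
have [i ui0] : exists i : ucomp IE, unit_action (usupp (usum i)) A != 0.
  apply/existsP; apply: contraT => /existsPn u0.
  case/negP: (simple_idm_neq0 A1); apply/eqP.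
  have [_ _ sum1] := uincP IE.
  rewrite -(unit_action_id A) -sum1 (linear_bigsum (unit_action_linear A)) big1 //.
  by move=> i _; have := u0 i; rewrite negbK /usupp uincl_usum => /eqP.
have [s Es] := simple_endo (unit_action (usupp (usum i)) A) A1.
have ss : s * s = s.
  apply: (scale_idm_inj A1); rewrite -scalerA -Es -[X in _ *: X]comp1m -compZl.
  by rewrite -Es unit_action_comp {2}/usupp compA usupp_uincl.
move: ui0; rewrite Es scaler_eq0 negb_or => /andP[s0 _]; exists i.
by rewrite Es -[s](mulfK s0) ss divff // scale1r.
Qed.

Lemma diagram_label_span (P : pred lbl) l (v : low l) (w : upp l) :
  P l -> diagram v w \in label_span P.
Proof.
move=> Pl; set x := diagram v w.
have -> : x = \sum_t x t *: ([ffun t' => (t' == t)%:R] : tube IC ID IM).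
  apply/ffunP=> t; rewrite sum_ffunE (bigD1 t) //= big1 => [|t' t't].
    by rewrite !ffunE eqxx addr0 [_ *: _]mulr1.
  by rewrite !ffunE eq_sym (negPf t't) [_ *: _]mulr0.
apply: memv_suml => t _; have [Pt|nPt] := boolP (P (tag t)).
  by rewrite memvZ // memv_span // map_f // mem_filter Pt mem_enum.
(* Outside the block of [l], coordinates take the default value [0] of [untag]. *)
rewrite ffunE untag_dflt ?scale0r ?mem0v //.
by apply: contraNneq nPt => ->.
Qed.

Lemma join_crossed_product (x y : tube IC ID IM) :
    x \in Rtube IC ID IM -> y \in Ltube IC ID IM ->
  join x y \in crossed_product IC ID IM.
Proof.
move=> /coord_vbasis -> /coord_vbasis ->.
rewrite (linear_bigsum ((join_bilinear _ _ _).1 _)).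
apply: memv_suml => i _; rewrite (linear_scale ((join_bilinear _ _ _).1 _)).
rewrite (linear_bigsum ((join_bilinear _ _ _).2 _)) memvZ //.
apply: memv_suml => j _; rewrite (linear_scale ((join_bilinear _ _ _).2 _)).
by rewrite memvZ // memv_span // allpairs_f // mem_nth ?size_tuple.
Qed.

Lemma diagram_crossed_product l (v : low l) (w : upp l) :
  diagram v w \in crossed_product IC ID IM.
Proof.
case: l v w => a b c e f h; rewrite /low /upp /= => v w.
have [i aP] := simple_unit_summand IC (iob_simple a).
have [j bP] := simple_unit_summand ID (iob_simple b).
have vE : v = \sum_(d : IM) \sum_(p < \dim {: hom (iob d) (iob a ⊳ iob e)})
    ((pbas p ∘ pdual p) ⊲m idm (iob b)) ∘ v.
  rewrite -[LHS]comp1m -ractm_id -(pbas_complete IM).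
  rewrite (linear_bigsum (ractm_linear_l _)) comp_suml; apply: eq_bigr => d _.
  by rewrite (linear_bigsum (ractm_linear_l _)) comp_suml.
have wE : w = \sum_(g : IM) \sum_(q < \dim {: hom (iob g) (iob a ⊳ iob f)})
    w ∘ ((pbas q ∘ pdual q) ⊲m idm (iob b)).
  rewrite -[LHS]compm1 -ractm_id -(pbas_complete IM).
  rewrite (linear_bigsum (ractm_linear_l _)) comp_sumr; apply: eq_bigr => g _.
  by rewrite (linear_bigsum (ractm_linear_l _)) comp_sumr.
have [dl dr] := diagram_bilinear (Label a b c e f h : lbl).
rewrite [v in diagram v]vE (linear_bigsum (dl _)); apply: memv_suml => d _.
rewrite (linear_bigsum (dl _)); apply: memv_suml => p _.
rewrite [X in diagram _ X]wE (linear_bigsum (dr _)); apply: memv_suml => g _.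
rewrite (linear_bigsum (dr _)); apply: memv_suml => q _.
pose r : lbl := Label (usum i) b c d g h.
pose l : lbl := Label a (usum j) d e f g.
pose el X := erase_l (usum i) (X : M) (iob b).
pose er X := erase_r (usum j) (X : M).
(* [v] is cut at [d] and [w] at [g]. Lower vertices gain a unit strand through the dagger of an
   erasing map, upper vertices through the erasing map itself. *)
pose vr : low r := (el _)^† ∘ ((pdual p ⊲m idm (iob b)) ∘ v).
pose wr : upp r := (w ∘ (pbas q ⊲m idm (iob b))) ∘ el _.
pose vl : low l := (er _)^† ∘ pbas p.
pose wl : upp l := pdual q ∘ er _.
suff -> : diagram (l := Label a b c e f h)
    (((pbas p ∘ pdual p) ⊲m idm (iob b)) ∘ v)
    (w ∘ ((pbas q ∘ pdual q) ⊲m idm (iob b))) =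
    join (diagram vr wr) (diagram vl wl).
  by apply: join_crossed_product; apply: diagram_label_span; apply: codom_f.
have lprojE (X : M) : lproj (usupp (usum i)) (iob a ⊳ X) = idm _.
  by rewrite lproj_lact aP lactm_id.
have rprojE (X : M) : rproj (usupp (usum j)) X ⊲m idm (iob b) = idm _.
  by rewrite rproj_ract bP ractm_id.
(* Erasing the inserted strands leaves [rproj] and [lproj]. The former slides onto [d] or [g] and is
   absorbed by [b], the latter onto [a ⊳ e] or [a ⊳ f] and is absorbed by [a]; the choice of [j] and
   [i] makes both trivial. *)
rewrite join_diagram; congr (diagram _ _).
  rewrite nu_ofE mu_ofE /= delta_refl compm1 /vl /vr !(compA _ (_^†)).
  rewrite erase_l_coisometry erase_r_coisometry rproj_nat.
  rewrite !ractm_compl rprojE compm1 -!compA [X in _ = _ ∘ X]compA.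
  by rewrite -(ractm_compl _ (lproj _ _)) lproj_nat lprojE compm1.
rewrite gamma_ofE zeta_ofE /= delta_refl comp1m /wl /wr -!(compA _ _ (_^†)).
rewrite erase_l_coisometry erase_r_coisometry -rproj_nat.
rewrite !ractm_compl rprojE comp1m -!compA.
by rewrite -(ractm_compl _ (lproj _ _)) lproj_nat lprojE compm1.
Qed.

Lemma memv_crossed_product (x : tube IC ID IM) : x \in crossed_product IC ID IM.
Proof.
move: x; apply: tube_ind => [k x y cx cy||]; last exact: diagram_crossed_product.
  by rewrite memvD ?memvZ.
exact: mem0v.
Qed.

Context (dM : module_qdim IC ID IM).
Local Notation cp := (crossed_product IC ID IM).
Local Notation proj := (vsproj cp).

(** Transport of structure: [vsproj] is inverse to [vsval] because the subspace is the whole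
    space. *)
Definition crossed_product_ops : wha_ops (subvs_of cp) :=
  WhaOps (fun x y => proj (tube_mul (vsval x) (vsval y)))
         (proj (tube_one IC ID IM))
         (fun x => tmap proj proj (tube_comul (vsval x)))
         (fun x => tube_counit (vsval x))
         (fun x => proj (tube_antipode dM (vsval x)))
         (fun x => proj (tube_star dM (vsval x))).

Let projK : cancel proj vsval.
Proof. by move=> x; rewrite vsprojK ?memv_crossed_product. Qed.

Lemma crossed_product_opsP : crossed_product_structure dM crossed_product_ops.
Proof.
split=> //=; split=> [k x y|x r l _ _ xE].
  by rewrite tube_comul_linear tmap_linear.
rewrite xE tube_comul_join tmapK //; exact: linearP.
Qed.

(** The operations were transported along [vsproj], which is therefore the isomorphism, with inverse
    [vsval]. *)
Lemma tube_algebra_isomorphic :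
  wha_isomorphic (tube_algebra dM) crossed_product_ops.
Proof.
exists (linfun proj); have fE : linfun proj =1 proj by apply: lfunE.
split=> /=.
- by exists (fun y : subvs_of cp => vsval y) => x; rewrite fE ?projK ?vsvalK.
- by split=> [x y|]; rewrite !fE ?projK.
- by split=> x; rewrite fE projK //; apply: eq_tmap => y; rewrite fE.
- by move=> x; rewrite !fE projK.
- by move=> x; rewrite !fE projK.
Qed.

End CrossedProduct.

Theorem proposition14 (R : realType) (C D : multifusion R[i])
    (M : bimodule_cat C D)
    (IC : multifusion_irr C) (ID : multifusion_irr D) (IM : irreducibles M)
    (dM : module_qdim IC ID IM) :
  exists H : wha_ops (subvs_of (crossed_product IC ID IM)),
    crossed_product_structure dM H /\ wha_isomorphic (tube_algebra dM) H.
Proof.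
exists (crossed_product_ops dM); split; first exact: crossed_product_opsP.
exact: tube_algebra_isomorphic.
Qed.
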